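(* Let $(M,E)$ be a Finsler space with Chern connection $\overset{\ast}{D}$, with $h$-curvature $\overset{\ast}{R}$ and $hv$-curvature $\overset{\ast}{P}$. For all $X,Y,Z\in\mathfrak{X}(TM)$ the following identities hold. (a) $\mathfrak{S}_{X,Y,Z}\{\overset{\ast}{R}(X,Y)Z\}=0$. (b) $\mathfrak{S}_{X,Y,Z}\{(\overset{\ast}{D}_{hX}\mathfrak{R})(Y,Z)\}=\mathfrak{S}_{X,Y,Z}\{\mathcal{C}'(F\mathfrak{R}(X,Y),Z)\}$. (c) $\overset{\ast}{P}(X,Y)Z=\overset{\ast}{P}(Z,Y)X$. (d) $\overset{\ast}{P}(X,Y)Z-\overset{\ast}{P}(X,Z)Y=(\overset{\ast}{D}_{JZ}\mathcal{C}')(X,Y)-(\overset{\ast}{D}_{JY}\mathcal{C}')(X,Z)$. (e) $\mathfrak{S}_{X,Y,Z}\{(\overset{\ast}{D}_{hX}\overset{\ast}{R})(Y,Z)\}=\mathfrak{S}_{X,Y,Z}\{\overset{\ast}{P}(X,F\mathfrak{R}(Y,Z))\}$. (f) $(\overset{\ast}{D}_{hX}\overset{\ast}{P})(Y,Z)-(\overset{\ast}{D}_{hY}\overset{\ast}{P})(X,Z)+(\overset{\ast}{D}_{JZ}\overset{\ast}{R})(X,Y)=\overset{\ast}{P}(X,F\mathcal{C}'(Y,Z))-\overset{\ast}{P}(Y,F\mathcal{C}'(X,Z))$. (g) $(\overset{\ast}{D}_{JY}\overset{\ast}{P})(X,Z)=(\overset{\ast}{D}_{JZ}\overset{\ast}{P})(X,Y)$.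 (Identities (a)-(d) are what the first Bianchi identity yields for the Chern connection, and (e)-(g) what the second Bianchi identity yields.)
   Context: Setting. $M$ is a real $C^\infty$ manifold of finite dimension $n$, $TM$ its tangent bundle, $\mathcal{T}M$ the bundle of nonzero tangent vectors. $J$ is the natural almost-tangent structure (vertical endomorphism) of $TM$ (locally $J(\partial/\partial x^i)=\partial/\partial y^i$, $J(\partial/\partial y^i)=0$) and $C=y^i\partial/\partial y^i$ is the Liouville vector field. Brackets of vector forms are Frölicher-Nijenhuis brackets; for a vector $1$-form $L$ and vector field $X$, $[X,L]Y=[X,LY]-L[X,Y]$, $[L,X]=-[X,L]$. Finsler space $(M,E)$: $E:TM\to\mathbb{R}$ with $E>0$ on $\mathcal{T}M$, $E(0)=0$, $E$ $C^\infty$ on $\mathcal{T}M$ and $C^1$ on $TM$, $\mathcal{L}_CE=2E$, and $\Omega:=dd_JE$ of maximal rank, where $d_JE(X)=dE(JX)$. Canonical spray $S$: $i_S\Omega=-dE$. Barthel connection: $\Gamma=[J,S]$, with projectors $h=\frac12(I+\Gamma)$, $v=\frac12(I-\Gamma)$; its curvature is $\mathfrak{R}=-\frac12[h,h]$, i.e. $\mathfrak{R}(X,Y)=-v[hX,hY]$. The almost-complex structure $F$ is defined by $FJ=h$, $Fh=-J$; the metric is $g(X,Y)=\Omega(X,FY)$. $\mathcal{C}'$ is the symmetric vertical-valued bilinear tensor defined by $\Omega(\mathcal{C}'(X,Y),Z)=\frac12(\mathcal{L}_{hX}g)(JY,JZ)$. Regularity convention: objects built from $E$ are smooth only on $\mathcal{T}M$;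 linear connections on $TM$ and vector fields in $\mathfrak{X}(TM)$ are understood on $\mathcal{T}M$. Chern connection: the unique linear connection $\overset{\ast}{D}$ on $TM$ such that $\overset{\ast}{D}J=0$, $\overset{\ast}{D}C=v$, $\overset{\ast}{D}\Gamma=0$, $\overset{\ast}{D}_{JX}JY=J[JX,Y]$ (i.e. a normal lift of $\Gamma$), $\overset{\ast}{D}_{hX}g=0$, and $J\,\overset{\ast}{T}(hX,hY)=0$ for all $X,Y$, where $\overset{\ast}{T}$ is its classical torsion. Explicitly it is determined by $\overset{\ast}{D}_{JX}JY=J[JX,Y]$, $\overset{\ast}{D}_{hX}JY=v[hX,JY]+\mathcal{C}'(X,Y)$, $\overset{\ast}{D}F=0$. With $K(X,Y)Z=\overset{\ast}{D}_X\overset{\ast}{D}_YZ-\overset{\ast}{D}_Y\overset{\ast}{D}_XZ-\overset{\ast}{D}_{[X,Y]}Z$, the $h$- and $hv$-curvatures are the tensors $\overset{\ast}{R}(X,Y)Z=K(hX,hY)JZ$ and $\overset{\ast}{P}(X,Y)Z=K(hX,JY)JZ$. In identities where the third argument is omitted, $\overset{\ast}{R}(X,Y)$ and $\overset{\ast}{P}(X,Y)$ denote the endomorphisms $W\mapsto\overset{\ast}{R}(X,Y)W$, $W\mapsto\overset{\ast}{P}(X,Y)W$, and the covariant derivatives are the usual covariant derivatives of the tensors, evaluated at the indicated arguments (and arbitrary $W$). $\mathfrak{S}_{X,Y,Z}$ denotes the cyclic sum over $X,Y,Z$. *)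

(* Defs.v *)
From mathcomp Require Import all_boot all_order all_algebra.
From mathcomp Require Import boolp classical_sets functions reals.
From mathcomp Require Import topology normedtype derive.

Set Implicit Arguments.
Unset Strict Implicit.
Unset Printing Implicit Defensive.

Import Order.TTheory GRing.Theory Num.Theory.
Import numFieldNormedType.Exports.

Local Open Scope classical_set_scope.
Local Open Scope ring_scope.

(* Vector fields, forms and tensors
   are handled through their values: a tensor is an operation on vector fields
   which is linear over the smooth functions. *)

Fixpoint Ck (R : realType) (V W : normedModType R) (k : nat)
    (U : set V) (f : V -> W) : Prop :=
  match k with
  | 0%N => forall x, U x -> {for x, continuous f}
  | k'.+1 => (forall x, U x -> differentiable f x) /\
             (forall v, Ck k' U ('D_v f))
  end.

Definition smooth (R : realType) (V W : normedModType R)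
    (U : set V) (f : V -> W) : Prop := forall k, Ck k U f.

(* cmap i is meaningful on dom i only; chart_at selects a chart at each point. *)
Record charts (R : realType) (T : Type) (n : nat) := Charts {
  idx : Type;
  dom : idx -> set T;
  cmap : idx -> T -> 'rV[R]_n;
  chart_at : T -> idx
}.

(* Local expression of f in the chart i, that is f \o (cmap i)^-1,
   extended by 0 outside the image of the chart. *)
Definition rep (R : realType) (T : Type) (n : nat) (A : charts R T n)
    (i : idx A) (W : normedModType R) (f : T -> W) (z : 'rV[R]_n) : W :=
  if pselect (exists2 p, dom i p & cmap i p = z) is left h
  then f (sval (cid2 h)) else 0.

Record manifold (R : realType) (n : nat) := Manifold {
  mpt :> topologicalType;
  atlas : charts R mpt n;
  manifold_hausdorff : hausdorff_space mpt;
  manifold_countable : @second_countable mpt;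
  dom_open : forall i : idx atlas, open (dom i);
  dom_cover : forall p, dom (chart_at atlas p) p;
  cmap_inj : forall (i : idx atlas) p q,
    dom i p -> dom i q -> cmap i p = cmap i q -> p = q;
  cmap_continuous : forall (i : idx atlas) p,
    dom i p -> {for p, continuous (cmap i)};
  cmap_open : forall (i : idx atlas) (U : set mpt),
    open U -> U `<=` dom i -> open (cmap i @` U);
  transition_smooth : forall i j : idx atlas,
    smooth (cmap i @` (dom i `&` dom j)) (rep i (cmap j))
}.

Section Calculus.
Variables (R : realType) (T : Type) (n : nat) (A : charts R T n).

Definition Ck_fun (k : nat) (f : T -> R) : Prop :=
  forall i : idx A, Ck k (cmap i @` dom i) (rep i f).

Definition smooth_fun (f : T -> R) : Prop := forall k, Ck_fun k f.

(* A tangent vector at p is the family of its components in all the charts at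
   p, related by the differentials of the transition maps.  The components in
   the other charts are set to 0, so that equality of tangent vectors is
   equality of families. *)
Definition is_tangent (p : T) (v : idx A -> 'rV[R]_n) : Prop :=
  (forall i j, dom i p -> dom j p ->
     v j = 'D_(v i) (rep i (cmap j)) (cmap i p)) /\
  (forall i, ~ dom i p -> v i = 0).

Definition rawfield : Type := T -> idx A -> 'rV[R]_n.

Definition is_vfield (X : rawfield) : Prop :=
  (forall p, is_tangent p (X p)) /\
  (forall i, smooth (cmap i @` dom i) (rep i (fun p => X p i))).

Definition scale_field (f : T -> R) (X : rawfield) : rawfield :=
  fun p i => f p *: X p i.

(* X . f, computed in the chart selected at each point *)
Definition lie_fun (X : rawfield) (f : T -> R) : T -> R :=
  fun p => let i := chart_at A p in 'D_(X p i) (rep i f) (cmap i p).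

(* [X, Y]^k = X^l d_l Y^k - Y^l d_l X^k in each chart *)
Definition bracket (X Y : rawfield) : rawfield :=
  fun p i => 'D_(X p i) (rep i (fun q => Y q i)) (cmap i p)
           - 'D_(Y p i) (rep i (fun q => X q i)) (cmap i p).

Definition d_fun (f : T -> R) : rawfield -> T -> R := fun X => lie_fun X f.

Definition d_form (alpha : rawfield -> T -> R) : rawfield -> rawfield -> T -> R :=
  fun X Y p =>
    lie_fun X (alpha Y) p - lie_fun Y (alpha X) p - alpha (bracket X Y) p.

(* L_X g for a bilinear form g *)
Definition lie_form2 (X : rawfield) (g : rawfield -> rawfield -> T -> R)
    (Y Z : rawfield) : T -> R :=
  fun p => lie_fun X (g Y Z) p - g (bracket X Y) Z p - g Y (bracket X Z) p.

Record is_vector_1form (L : rawfield -> rawfield) : Prop := {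
  v1f_field : forall X, is_vfield X -> is_vfield (L X);
  v1f_add : forall X Y, is_vfield X -> is_vfield Y -> L (X + Y) = L X + L Y;
  v1f_scale : forall f X, smooth_fun f -> is_vfield X ->
    L (scale_field f X) = scale_field f (L X)
}.

Record is_vector_2tensor (B : rawfield -> rawfield -> rawfield) : Prop := {
  v2t_left : forall Y, is_vfield Y -> is_vector_1form (fun X => B X Y);
  v2t_right : forall X, is_vfield X -> is_vector_1form (B X)
}.

(* Frölicher-Nijenhuis brackets: [X, L] for a vector field X and a vector
   1-form L, [L, X] = - [X, L], and [K, L] for two vector 1-forms. *)
Definition fn_field_form (X : rawfield) (L : rawfield -> rawfield) :
    rawfield -> rawfield :=
  fun Y => bracket X (L Y) - L (bracket X Y).

Definition fn_form_field (L : rawfield -> rawfield) (X : rawfield) :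
    rawfield -> rawfield :=
  fun Y => - fn_field_form X L Y.

Definition fn_form_form (K L : rawfield -> rawfield) :
    rawfield -> rawfield -> rawfield :=
  fun X Y => bracket (K X) (L Y) + bracket (L X) (K Y)
    + K (L (bracket X Y)) + L (K (bracket X Y))
    - K (bracket (L X) Y) - K (bracket X (L Y))
    - L (bracket (K X) Y) - L (bracket X (K Y)).

Record is_connection (D : rawfield -> rawfield -> rawfield) : Prop := {
  conn_field : forall X Y, is_vfield X -> is_vfield Y -> is_vfield (D X Y);
  conn_addl : forall X Y Z, is_vfield X -> is_vfield Y -> is_vfield Z ->
    D (X + Y) Z = D X Z + D Y Z;
  conn_scalel : forall f X Y, smooth_fun f -> is_vfield X -> is_vfield Y ->
    D (scale_field f X) Y = scale_field f (D X Y);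
  conn_addr : forall X Y Z, is_vfield X -> is_vfield Y -> is_vfield Z ->
    D X (Y + Z) = D X Y + D X Z;
  conn_leibniz : forall f X Y, smooth_fun f -> is_vfield X -> is_vfield Y ->
    D X (scale_field f Y) = scale_field (lie_fun X f) Y + scale_field f (D X Y)
}.

Definition torsion (D : rawfield -> rawfield -> rawfield) (X Y : rawfield) :
    rawfield :=
  D X Y - D Y X - bracket X Y.

Definition curvature (D : rawfield -> rawfield -> rawfield)
    (X Y Z : rawfield) : rawfield :=
  D X (D Y Z) - D Y (D X Z) - D (bracket X Y) Z.

(* Covariant derivatives in the direction Z: of a bilinear form, of a
   vector-valued bilinear tensor, of a vector-valued trilinear tensor. *)
Definition cov_form2 (D : rawfield -> rawfield -> rawfield) (Z : rawfield)
    (g : rawfield -> rawfield -> T -> R) (X Y : rawfield) : T -> R :=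
  fun p => lie_fun Z (g X Y) p - g (D Z X) Y p - g X (D Z Y) p.

Definition cov2 (D : rawfield -> rawfield -> rawfield) (Z : rawfield)
    (B : rawfield -> rawfield -> rawfield) (X Y : rawfield) : rawfield :=
  D Z (B X Y) - B (D Z X) Y - B X (D Z Y).

Definition cov3 (D : rawfield -> rawfield -> rawfield) (Z : rawfield)
    (Q : rawfield -> rawfield -> rawfield -> rawfield) (X Y W : rawfield) :
    rawfield :=
  D Z (Q X Y W) - Q (D Z X) Y W - Q X (D Z Y) W - Q X Y (D Z W).

End Calculus.

Section TangentBundle.
Variables (R : realType) (n : nat) (M : manifold R n).

Record tangent_bundle := TangentVector {
  tbase : M;
  tcomp : idx (atlas M) -> 'rV[R]_n;
  tangentP : is_tangent tbase tcomp
}.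

(* The chart i of M, with coordinates x, induces the chart (x, y) of TM, where
   y lists the components of the tangent vector in the chart i. *)
Definition TM_charts : charts R tangent_bundle (n + n) :=
  {| idx := idx (atlas M);
     dom := fun i u => dom i (tbase u);
     cmap := fun i u => row_mx (cmap i (tbase u)) (tcomp u i);
     chart_at := fun u => chart_at (atlas M) (tbase u) |}.

Definition slit_bundle := {u : tangent_bundle | tcomp u <> 0}.

Definition slit_charts : charts R slit_bundle (n + n) :=
  {| idx := idx TM_charts;
     dom := fun i u => dom (c := TM_charts) i (sval u);
     cmap := fun i u => cmap (c := TM_charts) i (sval u);
     chart_at := fun u => chart_at TM_charts (sval u) |}.

(* Objects built from the energy are smooth on nonzero vectors only, so that
   vector fields on TM are taken on the slit bundle. *)
Local Notation field := (rawfield slit_charts).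

Definition J (X : field) : field := fun u i => row_mx 0 (lsubmx (X u i)).

Definition Liouville : field := fun u i => row_mx 0 (tcomp (sval u) i).

Definition slit_fun (E : tangent_bundle -> R) : slit_bundle -> R :=
  fun u => E (sval u).

Definition d_J (f : slit_bundle -> R) : field -> slit_bundle -> R :=
  fun X => d_fun f (J X).

Definition Omega (E : tangent_bundle -> R) : field -> field -> slit_bundle -> R :=
  d_form (d_J (slit_fun E)).

(* As every tangent vector at u is the value at u of a vector field, fin_rank
   says that the bilinear form Omega_u on the tangent space at u is
   nondegenerate, for all u.  On the zero section L_C E = 2 E reads 0 = 0. *)
Record is_finsler (E : tangent_bundle -> R) : Prop := {
  fin_pos : forall u, tcomp u <> 0 -> 0 < E u;
  fin_zero : forall u, tcomp u = 0 -> E u = 0;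
  fin_smooth : smooth_fun slit_charts (slit_fun E);
  fin_C1 : Ck_fun TM_charts 1 E;
  fin_homogeneous : forall u, lie_fun Liouville (slit_fun E) u = 2 * slit_fun E u;
  fin_rank : forall (X : field) u, is_vfield X ->
    (forall Y : field, is_vfield Y -> Omega E X Y u = 0) -> X u = 0
}.

Definition is_canonical_spray (E : tangent_bundle -> R) (S : field) : Prop :=
  is_vfield S /\
  forall X, is_vfield X -> forall u, Omega E S X u = - d_fun (slit_fun E) X u.

Definition Barthel (S : field) : field -> field := fn_form_field J S.

Definition hproj (S X : field) : field := 2^-1 *: (X + Barthel S X).

Definition vproj (S X : field) : field := 2^-1 *: (X - Barthel S X).

Definition Barthel_curvature (S X Y : field) : field :=
  - (2^-1 *: fn_form_form (hproj S) (hproj S) X Y).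

Definition is_almost_complex (S : field) (F : field -> field) : Prop :=
  [/\ is_vector_1form F,
      (forall X, is_vfield X -> F (J X) = hproj S X) &
      (forall X, is_vfield X -> F (hproj S X) = - J X)].

Definition metric (E : tangent_bundle -> R) (F : field -> field) :
    field -> field -> slit_bundle -> R :=
  fun X Y => Omega E X (F Y).

Record is_second_Cartan (E : tangent_bundle -> R) (S : field)
    (F : field -> field) (C' : field -> field -> field) : Prop := {
  C'_tensor : is_vector_2tensor C';
  C'_sym : forall X Y, is_vfield X -> is_vfield Y -> C' X Y = C' Y X;
  C'_vertical : forall X Y, is_vfield X -> is_vfield Y -> J (C' X Y) = 0;
  C'_def : forall X Y Z, is_vfield X -> is_vfield Y -> is_vfield Z -> forall u,
    Omega E (C' X Y) Z u =
    2^-1 * lie_form2 (hproj S X) (metric E F) (J Y) (J Z) u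
}.

Record is_Chern (E : tangent_bundle -> R) (S : field) (F : field -> field)
    (D : field -> field -> field) : Prop := {
  Chern_connection : is_connection D;
  Chern_J : forall X Y, is_vfield X -> is_vfield Y -> D X (J Y) = J (D X Y);
  Chern_Liouville : forall X, is_vfield X -> D X Liouville = vproj S X;
  Chern_Barthel : forall X Y, is_vfield X -> is_vfield Y ->
    D X (Barthel S Y) = Barthel S (D X Y);
  Chern_vertical : forall X Y, is_vfield X -> is_vfield Y ->
    D (J X) (J Y) = J (bracket (J X) Y);
  Chern_metric : forall X Y Z, is_vfield X -> is_vfield Y -> is_vfield Z ->
    forall u, cov_form2 D (hproj S X) (metric E F) Y Z u = 0;
  Chern_torsion : forall X Y, is_vfield X -> is_vfield Y ->
    J (torsion D (hproj S X) (hproj S Y)) = 0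
}.

Definition h_curv (S : field) (D : field -> field -> field) (X Y Z : field) :
    field :=
  curvature D (hproj S X) (hproj S Y) (J Z).

Definition hv_curv (S : field) (D : field -> field -> field) (X Y Z : field) :
    field :=
  curvature D (hproj S X) (J Y) (J Z).

Definition cyclic_sum (f : field -> field -> field -> field) (X Y Z : field) :
    field :=
  f X Y Z + f Y Z X + f Z X Y.

End TangentBundle.

(* Main.v *)
From HB Require Import structures.
Require Import Defs.
From mathcomp Require Import all_boot all_order all_algebra sesquilinear.
From mathcomp Require Import boolp classical_sets functions reals.
From mathcomp Require Import topology normedtype landau derive.
From mathcomp Require Import ring.

(** Why the identities hold.

A connection [D] over a Lie bracket, with torsion [T] and curvature [K],
satisfies two Bianchi identities
- [Cyc{K(X,Y)Z} = Cyc{(D_X T)(Y,Z) + T(T(X,Y),Z)}],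
- [Cyc{(D_X K)(Y,Z) + K(T(X,Y),Z)} = 0],
where [Cyc] is the cyclic sum over [X], [Y], [Z].  They are formal consequences of the Jacobi
identity ([bianchi1], [bianchi2]).

For the Chern connection, [D] commutes with [J], with the projectors [h], [v]
of the Barthel connection and with [F], and the torsion is
- [T(hX,hY)] = the Barthel curvature [Rb(X,Y)] ([tors_hh]),
- [T(hX,JY) = C'(X,Y)] ([tors_hv]),
- [T(JX,JY) = 0] ([tors_vv]),
so that [T] and all its covariant derivatives are vertical.  Hence [J] of the
cyclic sum of the curvature vanishes ([J_bianchi]), which gives (a), (c) and
[K(JX,JY) = 0] ([curv_vertical]).  On three horizontal arguments the left-hand
side of the first identity is horizontal while the right-hand side is
vertical, so both vanish and the second one is (b).  On one horizontal and two
vertical arguments the first identity is (d).  The second identity on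
[(h,h,h)], [(h,h,J)], [(h,J,J)] is (e), (f), (g).

The value of [T(hX,JY)] amounts to the explicit formula
[D_hX JY = v[hX,JY] + C'(X,Y)] ([chern_hor_J]).  The difference
[B(X,Y) = D_hX JY - v[hX,JY]] is symmetric because the connection has no
horizontal torsion and [[J,Gamma] = 0]; metricity together with the definition
and the symmetry of [C'] makes [Omega(B(X,Y),Z)] totally symmetric and equal to
[Omega(C'(X,Y),Z)].  Two facts about the canonical spray enter.
- [Omega] vanishes on horizontal vectors ([Om_hor]): [L_S Omega = 0], because
  [i_S Omega = - dE], and [J] is skew for [Omega], hence [Gamma = [J,S]] is
  skew too in the sense of [Om_barthel].
- [JS = C] ([spray_semispray]), by nondegeneracy of [Omega] and
  [i_C Omega = d_J E]; this is what makes [Gamma] an almost-product structure.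

These arguments use vector fields only through the Lie bracket and [J], and so
they are carried out in an abstract module with a bracket.  What remains is to
show that the smooth vector fields on the slit tangent bundle form such a
module: smoothness and chart independence of the bracket come from the Schwarz
theorem on mixed derivatives ([schwarz], [vfield_bracket]), the Jacobi identity
from the commutator formula ([bracket_jacobi]), and the induced charts of the
slit bundle have smooth transitions [(x,y) |-> (phi x, D_y phi x)]
([slit_is_atlas]). *)

Set Implicit Arguments.
Unset Strict Implicit.
Unset Printing Implicit Defensive.

Import Order.TTheory GRing.Theory Num.Theory.
Import numFieldNormedType.Exports.

Local Open Scope classical_set_scope.
Local Open Scope ring_scope.

(** * Identities in abelian groups *)

Ltac cancel_last a t :=
  lazymatch a with
  | ?b + ?c =>
    lazymatch t with
    | - c => rewrite (addrK c b)
    | _ => lazymatch c with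
      | - t => rewrite (subrK t b)
      | t => cancel_last b t
      | _ => rewrite (addrAC b c t); cancel_last b t
      end
    end
  | - t => rewrite (addNr t) ?add0r
  | _ => lazymatch t with - a => rewrite (subrr a) ?add0r end
  end.

Ltac generalize_atoms t :=
  lazymatch t with
  | ?a + ?b => generalize_atoms a; generalize_atoms b
  | - ?a => generalize_atoms a
  | 0 => idtac
  | _ => tryif is_var t then idtac else (generalize t; intro)
  end.

(** Once the atoms are variables and both sides are expanded into one sum, the
last term is cancelled against an opposite term, which commutativity brings to
the end. *)
Ltac abel :=
  lazymatch goal with |- ?a = ?b => generalize_atoms a; generalize_atoms b end;
  apply/subr0_eq; rewrite ?(opprD, opprK, oppr0, addr0, add0r, addrA);
  repeat (lazymatch goal with |- ?a + ?t = 0 => cancel_last a t end);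
  reflexivity.

(** * Maps of class C^k on open sets *)

Section Germs.
Variables (R : realType) (V W : normedModType R).
Implicit Types (f g : V -> W) (U : set V).

(** Local expressions of functions are extended by 0 outside the image of a
chart, so they agree with the expected formulas only near a point. *)
Lemma near_eq_differentiable f g x :
  (\forall z \near x, f z = g z) -> differentiable f x -> differentiable g x.
Proof.
move=> fg df; rewrite -(subrKC f g); apply: differentiableD => //.
have H : (g - f) \o shift x = cst ((g - f) x) + (\0 : V -> W) +o_ 0 id.
  apply/eqaddoP => e e0.
  have x0 : (g - f) x = 0 by rewrite -[LHS]/(g x - f x) (nbhs_singleton fg) subrr.
  have : \forall y \near 0, f (y + x) = g (y + x).
    by rewrite (near_shift x) sub0r; near do rewrite /= subrK.
  apply: filterS => y fgy; rewrite -[X in `|X|]/(g (y + x) - f (y + x) - ((g - f) x + 0)).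
  rewrite x0 addr0 subr0 fgy subrr.
  by rewrite normr0 mulr_ge0 // ltW.
apply/diff_locallyP; rewrite (diff_unique _ H); last exact: cst_continuous.
by split; first exact: cst_continuous.
Unshelve. all: by end_near. Qed.

Lemma open_eq_derive U f g v x : open U -> U x ->
  (forall z, U z -> f z = g z) -> 'D_v f x = 'D_v g x.
Proof.
by move=> oU Ux fg; apply: near_eq_derive; near do apply: fg; exact: open_nbhs_nbhs.
Unshelve. all: by end_near. Qed.

Lemma Ck_ext k U f g : open U -> (forall z, U z -> f z = g z) ->
  Ck k U f -> Ck k U g.
Proof.
move=> oU; elim: k f g => [|k IH] f g fg /=.
  move=> cf x Ux; rewrite /prop_for /continuous_at /= -(fg x Ux).
  apply: cvg_trans (cf x Ux); apply: near_eq_cvg.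
  by near do apply: fg; exact: open_nbhs_nbhs.
move=> [df Cf]; split=> [x Ux|v].
  apply: near_eq_differentiable (df x Ux).
  by near do apply: fg; exact: open_nbhs_nbhs.
by apply: IH (Cf v) => z Uz; apply: open_eq_derive fg.
Unshelve. all: by end_near. Qed.

End Germs.

(** The product rule, from the differential of the bilinear map [*:%R]. *)
Lemma differentiable_scale (R : realType) (V W : normedModType R)
    (k : V -> R) (f : V -> W) x :
  differentiable k x -> differentiable f x ->
  differentiable (fun z => k z *: f z) x /\
  forall v, 'D_v (fun z => k z *: f z) x = 'D_v k x *: f x + k x *: 'D_v f x.
Proof.
move=> dk df.
have bil : bilinear_for (GRing.Scale.Law.clone _ _ *:%R _)
    (GRing.Scale.Law.clone _ _ *:%R _) (@GRing.scale R W).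
  by split=> [u'|u] a y z /=; rewrite ?scalerDl ?scalerDr !scalerA ?(mulrC u).
pose bM := bilinear_isBilinear.Build R R W W _ _ (@GRing.scale R W) bil.
pose b : {bilinear R -> W -> W} := HB.pack (@GRing.scale R W) bM.
have cb : continuous (fun p : R * W => b p.1 p.2) by exact: scale_continuous.
have db := differentiable_bilin (k x, f x) cb.
have dp := differentiable_pair dk df.
have dc := differentiable_comp dp db.
split=> [//|v]; rewrite (deriveE _ dc) [LHS](congr1 (@^~ v) (diff_comp dp db)).
rewrite /= (diff_bilin _ cb) diff_pair //= -!deriveE // addrC.
by rewrite /b.
Qed.

Lemma CkW (R : realType) (V W : normedModType R) (U : set V) k (f : V -> W) :
  Ck k.+1 U f -> Ck k U f.
Proof.
elim: k f => [|k IH] f [df Cf].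
  by move=> x Ux; apply: differentiable_continuous; exact: df.
by split=> // v; apply: IH.
Qed.

Section Smooth.
Variables (R : realType) (V W : normedModType R) (U : set V).
Hypothesis oU : open U.
Implicit Types (f g : V -> W).

Lemma Ck_cst k (a : W) : Ck k U (fun=> a).
Proof.
elim: k a => [|k IH] a /=; first by move=> x _; exact: cvg_cst.
split=> [x _|v]; first exact: differentiable_cst.
by apply: Ck_ext (IH 0) => // z _; rewrite derive_cst.
Qed.

Lemma CkD k f g : Ck k U f -> Ck k U g -> Ck k U (fun x => f x + g x).
Proof.
elim: k f g => [|k IH] f g.
  by move=> cf cg x Ux; apply: continuousD; [exact: cf|exact: cg].
move=> [df Cf] [dg Cg]; split=> [x Ux|v].
  by apply: differentiableD; [exact: df|exact: dg].
apply: Ck_ext (IH _ _ (Cf v) (Cg v)) => // z Uz.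
by rewrite -deriveD //; apply: diff_derivable; [exact: df|exact: dg].
Qed.

Lemma Ck_scale k (c : V -> R) f :
  Ck k U c -> Ck k U f -> Ck k U (fun x => c x *: f x).
Proof.
elim: k c f => [|k IH] c f.
  by move=> cc cf x Ux; apply: cvgZ; [exact: cc|exact: cf].
move=> Cc Cf; have [dc Dc] := Cc; have [df Df] := Cf; split=> [x Ux|v].
  by have [] := differentiable_scale (dc x Ux) (df x Ux).
have := CkD (IH _ _ (Dc v) (CkW Cf)) (IH _ _ (CkW Cc) (Df v)).
apply: Ck_ext => // z Uz.
by have [_ ->] := differentiable_scale (dc z Uz) (df z Uz).
Qed.

Lemma Ck_sum k (I : Type) (r : seq I) (F : I -> V -> W) :
  (forall i, Ck k U (F i)) -> Ck k U (fun x => \sum_(i <- r) F i x).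
Proof.
move=> CF; elim: r => [|i r IH].
  by apply: Ck_ext (Ck_cst k 0) => // x _; rewrite big_nil.
by apply: Ck_ext (CkD (CF i) IH) => // x _; rewrite big_cons.
Qed.

Lemma Ck_linear k (W' : normedModType R) (L : {linear W -> W'}) f :
  continuous L -> Ck k U f -> Ck k U (fun x => L (f x)).
Proof.
move=> cL; elim: k f => [|k IH] f.
  by move=> cf x Ux; apply: (continuous_comp (cf x Ux)); exact: cL.
move=> [df Cf]; split=> [x Ux|v].
  apply: differentiable_comp; first exact: df.
  exact: linear_differentiable.
apply: Ck_ext (IH _ (Cf v)) => // z Uz.
have dL : differentiable L (f z) by exact: linear_differentiable.
rewrite [RHS]deriveE; last exact: differentiable_comp (df z Uz) dL.
rewrite [RHS](congr1 (@^~ v) (diff_comp (df z Uz) dL)) /= diff_lin //.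
by rewrite -deriveE //; exact: df.
Qed.

End Smooth.

Lemma derive_linear_comp (R : realType) (V W W' : normedModType R)
    (L : {linear W -> W'}) (f : V -> W) x v :
  continuous L -> differentiable f x -> 'D_v (fun z => L (f z)) x = L ('D_v f x).
Proof.
move=> cL df; have dL : differentiable L (f x) by exact: linear_differentiable.
rewrite deriveE; last exact: differentiable_comp df dL.
by rewrite [LHS](congr1 (@^~ v) (diff_comp df dL)) /= diff_lin // -deriveE.
Qed.

Lemma derive_comp (R : realType) (V V' W : normedModType R)
    (f : V -> V') (g : V' -> W) x v :
  differentiable f x -> differentiable g (f x) ->
  'D_v (fun z => g (f z)) x = 'D_('D_v f x) g (f x).
Proof.
move=> df dg; rewrite (deriveE _ dg) (deriveE _ df).
rewrite deriveE; last exact: differentiable_comp df dg.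
by rewrite [LHS](congr1 (@^~ v) (diff_comp df dg)).
Qed.

Lemma Ck_precomp (R : realType) (V V' W : normedModType R)
    (L : {linear V -> V'}) (U : set V) (U' : set V') k (f : V' -> W) :
  open U -> continuous L -> (forall x, U x -> U' (L x)) ->
  Ck k U' f -> Ck k U (fun x => f (L x)).
Proof.
move=> oU cL UU'; elim: k f => [|k IH] f.
  move=> cf x Ux; apply: (continuous_comp (cL x)); exact: cf (UU' x Ux).
move=> [df Cf].
have dL x : differentiable L x by exact: linear_differentiable.
split=> [x Ux|v].
  by apply: differentiable_comp (dL x) _; exact: df (UU' x Ux).
apply: Ck_ext (IH _ (Cf (L v))) => // z Uz.
rewrite (derive_comp v (dL z) (df _ (UU' z Uz))).
by rewrite (deriveE v (dL z)) diff_lin.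
Qed.

Lemma linear_rV_continuous (R : realType) m (W : normedModType R)
    (L : {linear 'rV[R]_m -> W}) : continuous L.
Proof.
have -> : L = (fun x => \sum_k x 0 k *: L (delta_mx 0 k)) :> (_ -> _).
  apply/funext => x; rewrite [in LHS](row_sum_delta x) linear_sum.
  by apply: eq_bigr => k _; rewrite linearZ.
move=> x; apply: (Ck_sum openT (k := 0%N)) => // k y _.
apply: (@cvgZr_tmp _ _ _ (nbhs y) _ (fun z : 'rV[R]_m => z 0 k)).
exact: coord_continuous.
Qed.

Section DirectionalDerivative.
Variables (R : realType) (m : nat) (W : normedModType R) (U : set 'rV[R]_m).
Hypothesis oU : open U.
Implicit Types (f : 'rV[R]_m -> W) (X : 'rV[R]_m -> 'rV[R]_m).

Lemma derive_coord f z w : differentiable f z ->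
  'D_w f z = \sum_k w 0 k *: 'D_(delta_mx 0 k) f z.
Proof.
move=> df; rewrite deriveE // [in LHS](row_sum_delta w) linear_sum.
by apply: eq_bigr => k _; rewrite linearZ deriveE.
Qed.

Lemma Ck_derive_along k X f : Ck k U X -> Ck k.+1 U f ->
  Ck k U (fun z => 'D_(X z) f z).
Proof.
move=> CX [df Cf].
have : Ck k U (fun z => \sum_i X z 0 i *: 'D_(delta_mx 0 i) f z).
  apply: Ck_sum => // i; apply: Ck_scale => //; last exact: Cf.
  have @L : {linear 'rV[R]_m -> R}.
    by exists (fun N : 'rV[R]_m => N 0 i); do 2![eexists]; do ?[constructor];
     rewrite ?mxE// => ? *; rewrite ?mxE//; move=> ?; rewrite !mxE.
  exact: (Ck_linear oU (@linear_rV_continuous _ _ _ L) CX).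
by apply: Ck_ext => // z Uz; rewrite -derive_coord //; exact: df.
Qed.

(** Expand the inner derivative in coordinates and use the product rule in each
of them. *)
Lemma derive_derive_along X f x v : U x -> differentiable X x -> Ck 2 U f ->
  'D_v (fun z => 'D_(X z) f z) x = 'D_('D_v X x) f x + 'D_v ('D_(X x) f) x.
Proof.
move=> Ux dX [df Cf].
have dDf w : differentiable ('D_w f) x by have [+ _] := Cf w; apply.
have dc i : differentiable (fun z => X z 0 i) x.
  exact: (differentiable_comp dX (differentiable_coord _ _ _)).
have dXi i : 'D_v (fun z => X z 0 i) x = 'D_v X x 0 i.
  by rewrite derive_mx ?mxE //; exact: diff_derivable.
have E (c : 'rV[R]_m -> 'rV[R]_m) : differentiable c x ->
    'D_v (fun z => 'D_(c z) f z) x = 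
    \sum_i 'D_v (fun z => c z 0 i *: 'D_(delta_mx 0 i) f z) x.
  move=> dcx; have dci i : differentiable (fun z => c z 0 i) x.
    exact: (differentiable_comp dcx (differentiable_coord _ _ _)).
  rewrite -derive_sum => [|i]; last first.
    apply: diff_derivable.
    by have [] := differentiable_scale (dci i) (dDf (delta_mx 0 i)).
  apply: open_eq_derive oU Ux _ => z Uz.
  by rewrite derive_coord ?fct_sumE //; exact: df.
rewrite (E _ dX) (E (fun=> X x)); last exact: differentiable_cst.
rewrite derive_coord; last exact: df.
rewrite -big_split; apply: eq_bigr => i _ /=.
have [_ ->] := differentiable_scale (dc i) (dDf (delta_mx 0 i)).
have [_ ->] := differentiable_scale (differentiable_cst (X x 0 i) x)
  (dDf (delta_mx 0 i)).
by rewrite derive_cst scale0r add0r dXi.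
Qed.

End DirectionalDerivative.

(** * Symmetry of mixed derivatives *)

Section Schwarz.
Variables (R : realType) (V : normedModType R) (U : set V).
Hypothesis oU : open U.

Lemma is_derive_line (f : V -> R) u y r : differentiable f (r *: u + y) ->
  is_derive r 1 (fun s => f (s *: u + y)) ('D_u f (r *: u + y)).
Proof.
move=> df.
have dl : is_diff r (fun s : R => s *: u + y) ( *:%R^~ u).
  by apply: is_diff_eq; rewrite addr0.
have dc := differentiable_comp (ex_diff (is_diff_def := dl)) df.
apply: DeriveDef; first exact: diff_derivable.
rewrite derive_comp //.
by congr ('D__ _ _); rewrite deriveE // diff_val scale1r.
Qed.

Lemma MVT_line (f : V -> R) u y t : 0 < t ->
  (forall r, r \in `[0, t] -> differentiable f (r *: u + y)) ->
  exists2 r, r \in `[0, t] & f (t *: u + y) - f y = 'D_u f (r *: u + y) * t.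
Proof.
move=> t0 df.
have [||r rt] := @MVT R (fun s => f (s *: u + y))
    (fun s => 'D_u f (s *: u + y)) 0 t t0.
- by move=> r rt; apply: is_derive_line; apply: df; apply: subset_itv_oo_cc rt.
- apply: derivable_within_continuous => r rt.
  by have [] := is_derive_line (df r rt).
rewrite scale0r add0r subr0 => E; exists r => //.
exact: subset_itv_oo_cc rt.
Qed.

(** Two applications of the mean value theorem turn the second difference
quotient into a mixed derivative at an intermediate point.  The second
difference is symmetric in the two directions, the mixed derivative a priori is
not. *)
Lemma second_difference (f : V -> R) u v x t : 0 < t -> Ck 2 U f ->
  (forall r s, r \in `[0, t] -> s \in `[0, t] -> U (s *: v + (r *: u + x))) ->
  exists2 rs, rs.1 \in `[0, t] /\ rs.2 \in `[0, t] &
    f (t *: v + (t *: u + x)) - f (t *: u + x) - f (t *: v + x) + f x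
    = 'D_v ('D_u f) (rs.2 *: v + (rs.1 *: u + x)) * t * t.
Proof.
move=> t0 [df Cf] inU.
have t00 : 0 \in `[0, t] by rewrite in_itv /= lexx ltW.
have tt : t \in `[0, t] by rewrite in_itv /= lexx ltW.
(* The mean value theorem is used along u for g, then along v for 'D_u f. *)
pose g := fun z => f (t *: v + z) - f z.
have dg z : U (t *: v + z) -> U z -> differentiable g z.
  move=> U1 U2; apply: differentiableB; last exact: df.
  apply: (differentiable_comp (f := fun z => t *: v + z)) => //.
  exact: df.
have [|r rt Er] := @MVT_line g u x t t0.
  move=> r rt; apply: dg; first exact: inU.
  by have := inU r 0 rt t00; rewrite scale0r add0r.
have [|s st Es] := @MVT_line ('D_u f) v (r *: u + x) t t0.
  by move=> s st; have [+ _] := Cf u; apply; exact: inU.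
exists (r, s) => //=; rewrite -Es.
have -> : f (t *: v + (t *: u + x)) - f (t *: u + x) - f (t *: v + x) + f x
  = g (t *: u + x) - g x by rewrite /g; ring.
rewrite Er; congr (_ * _).
have U1 := inU r t rt tt.
have U0 : U (r *: u + x) by have := inU r 0 rt t00; rewrite scale0r add0r.
have dl z : differentiable (fun z => t *: v + z) z by [].
rewrite /g deriveB; first congr (_ - _).
- rewrite (derive_comp u (dl _) (df _ U1)); congr ('D__ _ _).
  by rewrite deriveE // diff_val add0r.
- apply: diff_derivable.
  exact: (differentiable_comp (f := fun z => t *: v + z) (dl _) (df _ U1)).
- by apply: diff_derivable; exact: df.
Qed.

End Schwarz.

(** The two values are compared at different points near [x], as the mean value
theorem gives no control on the intermediate points. *)
Lemma continuous_eq_limit (R : realType) (V : normedModType R)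
    (a b : V -> R) x :
  {for x, continuous a} -> {for x, continuous b} ->
  (forall d, 0 < d -> exists y z, [/\ ball x d y, ball x d z & a y = b z]) ->
  a x = b x.
Proof.
move=> ca cb ab.
suff small (e : R) : 0 < e -> `|a x - b x| <= e.
  apply/eqP; rewrite -subr_eq0 -normr_le0; apply/ler_addgt0Pl => e e0.
  by rewrite addr0; exact: small.
move=> e0; have e20 : 0 < e / 2 by rewrite divr_gt0.
have near_le (g : V -> R) : {for x, continuous g} ->
    nbhs x [set z | `|g x - g z| < e / 2].
  by move=> /cvgrPdist_lt/(_ _ e20).
have : nbhs x ([set z | `|a x - a z| < e / 2] `&` [set z | `|b x - b z| < e / 2]).
  by apply: filterI; exact: near_le.
move=> /nbhs_ballP[d /= d0 inB].
have [y [z [/inB[H1 _] /inB[_ H2] yz]]] := ab d d0.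
rewrite ltW // (splitr e) -(subrKA (a y)) {2}yz.
by rewrite (le_lt_trans (ler_normD _ _)) // ltrD // distrC.
Qed.

(** Compare the two expressions of one second difference given by
[second_difference] on arbitrarily small parallelograms at [x]. *)
Lemma schwarz_real (R : realType) (V : normedModType R) (U : set V)
    (f : V -> R) u v x : open U -> U x -> Ck 2 U f ->
  'D_u ('D_v f) x = 'D_v ('D_u f) x.
Proof.
move=> oU Ux Cf; have [_ C1] := Cf.
have [_ /(_ u) Cvu] := C1 v; have [_ /(_ v) Cuv] := C1 u.
apply: (continuous_eq_limit (Cvu x Ux) (Cuv x Ux)) => e e0.
have /nbhs_ballP[d' /= d'0 inU] : nbhs x U by exact: open_nbhs_nbhs.
pose d := Num.min d' e.
have d0 : 0 < d by rewrite lt_min d'0.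
(* All r u + s v with 0 <= r, s <= t have norm at most t c = d / 2 < d. *)
pose c := `|u| + `|v| + 1; have c0 : 0 < c by rewrite ltr_wpDl ?addr_ge0.
pose t := d / 2 / c; have t0 : 0 < t by rewrite !divr_gt0.
have tE : t * c = d / 2 by rewrite divfK ?gt_eqF.
have ballP r s (w w' : V) : r \in `[0, t] -> s \in `[0, t] ->
    `|w| + `|w'| <= c -> ball x d (s *: w' + (r *: w + x)).
  rewrite !in_itv /= => /andP[r0 rt] /andP[s0 st] wc.
  rewrite -ball_normE /= addrA opprD addrCA subrr addr0 normrN.
  apply: le_lt_trans (_ : d / 2 < d); last by rewrite ltr_pdivrMr ?ltr_pMr ?ltr1n.
  rewrite (le_trans (ler_normD _ _)) // !normrZ !ger0_norm // -tE.
  rewrite (le_trans (lerD (ler_wpM2r _ st) (ler_wpM2r _ rt))) //.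
  by rewrite -mulrDr addrC ler_wpM2l // ltW.
have ballU y : ball x d y -> U y.
  by move=> yd; apply: inU; apply: le_ball yd; rewrite ge_min lexx.
have balle y : ball x d y -> ball x e y.
  by move=> yd; apply: le_ball yd; rewrite ge_min lexx orbT.
have uvc : `|u| + `|v| <= c by rewrite lerDl.
have vuc : `|v| + `|u| <= c by rewrite addrC.
have [r s rI sI|[r s] /= [rI sI] E1] :=
    second_difference (u := u) (v := v) (x := x) t0 Cf.
  exact/ballU/ballP.
have [r' s' rI' sI'|[r' s'] /= [rI' sI'] E2] :=
    second_difference (u := v) (v := u) (x := x) t0 Cf.
  exact/ballU/ballP.
exists (s' *: u + (r' *: v + x)), (s *: v + (r *: u + x)).
split; [exact/balle/ballP|exact/balle/ballP|].
apply: (mulIf (lt0r_neq0 t0)); apply: (mulIf (lt0r_neq0 t0)).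
apply: etrans (esym E2) (etrans _ E1).
by rewrite (addrCA (t *: v)); ring.
Qed.

Lemma schwarz (R : realType) (V : normedModType R) (U : set V) p q
    (f : V -> 'M[R]_(p, q)) u v x : open U -> U x -> Ck 2 U f ->
  'D_u ('D_v f) x = 'D_v ('D_u f) x.
Proof.
move=> oU Ux Cf; have [df C1] := Cf; apply/matrixP => i j.
have coord (w w' : V) : 'D_w ('D_w' f) x i j = 'D_w ('D_w' (fun z => f z i j)) x.
  have [dw _] := C1 w'.
  rewrite derive_mx ?mxE; last by apply: diff_derivable; exact: dw.
  apply: open_eq_derive oU Ux _ => z Uz.
  by rewrite derive_mx ?mxE //; apply: diff_derivable; exact: df.
apply: etrans (coord u v) _.
apply: etrans _ (esym (coord v u)).
apply: (schwarz_real _ _ oU Ux).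
have dcoord (g : V -> 'M[R]_(p, q)) z : differentiable g z -> differentiable (fun z => g z i j) z.
  by move=> dg; apply: (differentiable_comp dg (differentiable_coord _ _ _)).
have ccoord (g : V -> 'M[R]_(p, q)) : Ck 0 U g -> Ck 0 U (fun z => g z i j).
  move=> cg z Uz; apply: (@continuous_comp _ _ _ g (fun N => N i j) z (cg z Uz)).
  exact: coord_continuous.
split=> [z Uz|w]; first by apply: dcoord; exact: df.
have [dw Cw] := C1 w; split=> [z Uz|w'].
  apply: near_eq_differentiable (dcoord _ _ (dw z Uz)).
  near=> y; rewrite derive_mx ?mxE //; apply: diff_derivable; apply: df.
  by near: y; exact: open_nbhs_nbhs.
apply: Ck_ext (ccoord _ (Cw w')) => // z Uz.
rewrite derive_mx ?mxE; last by apply: diff_derivable; exact: dw.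
apply: open_eq_derive oU Uz _ => y Uy.
by rewrite derive_mx ?mxE //; apply: diff_derivable; exact: df.
Unshelve. all: by end_near. Qed.

Local Opaque derive diff.

(** * Vector fields in an atlas *)

Section DirectionLinearity.
Variables (R : realType) (V W : normedModType R) (f : V -> W) (x : V).
Hypothesis df : differentiable f x.

Lemma deriveDl a b : 'D_(a + b) f x = 'D_a f x + 'D_b f x.
Proof. by rewrite !deriveE // linearD. Qed.

Lemma deriveBl a b : 'D_(a - b) f x = 'D_a f x - 'D_b f x.
Proof. by rewrite !deriveE // linearB. Qed.

Lemma deriveZl c a : 'D_(c *: a) f x = c *: 'D_a f x.
Proof. by rewrite !deriveE // linearZ. Qed.

End DirectionLinearity.

(** The bracket of vector fields acts as the commutator of derivations: the
second derivatives of [f] cancel by symmetry. *)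
Lemma derive_commutator (R : realType) m (W : normedModType R)
    (U : set 'rV[R]_m) (X Y : 'rV[R]_m -> 'rV[R]_m) (f : 'rV[R]_m -> W) x :
  open U -> U x -> differentiable X x -> differentiable Y x -> Ck 2 U f ->
  (forall u v, 'D_u ('D_v f) x = 'D_v ('D_u f) x) ->
  'D_('D_(X x) Y x - 'D_(Y x) X x) f x =
  'D_(X x) (fun z => 'D_(Y z) f z) x - 'D_(Y x) (fun z => 'D_(X z) f z) x.
Proof.
move=> oU Ux dX dY Cf sym; have [df _] := Cf.
rewrite (derive_derive_along oU _ Ux dY Cf) (derive_derive_along oU _ Ux dX Cf).
rewrite (deriveBl (df x Ux)) (sym (X x) (Y x)); abel.
Qed.

(** What the calculus of vector fields uses of a manifold, expressed through the
charts: it applies to a manifold and to its slit tangent bundle, a set of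
vectors that is given with charts and without a topology. *)
Record is_atlas (R : realType) (T : Type) (n : nat) (A : charts R T n) : Prop := {
  at_cover : forall p, dom (chart_at A p) p;
  at_inj : forall (i : idx A) p q,
    dom i p -> dom i q -> cmap i p = cmap i q -> p = q;
  at_open : forall i j : idx A, open (cmap i @` (dom i `&` dom j));
  at_smooth : forall i j : idx A,
    smooth (cmap i @` (dom i `&` dom j)) (rep i (cmap j))
}.

Arguments at_open {R T n A} _ i j.
Arguments at_smooth {R T n A} _ i j.

Section Rep.
Variables (R : realType) (T : Type) (n : nat) (A : charts R T n).
Implicit Types (i j : idx A) (p : T) (W : normedModType R).

Lemma rep_comp2 i W1 W2 W' (L : W1 -> W2 -> W') (f : T -> W1) (g : T -> W2) :
  L 0 0 = 0 ->
  rep i (fun p => L (f p) (g p)) = (fun z => L (rep i f z) (rep i g z)).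
Proof. by move=> L0; apply/funext => z; rewrite /rep; case: pselect. Qed.

Definition img i : set 'rV[R]_n := cmap i @` dom i.

Definition loc (X : rawfield A) i : 'rV[R]_n -> 'rV[R]_n :=
  rep i (fun p => X p i).

Hypothesis HA : is_atlas A.

Lemma rep_cmap i W (f : T -> W) p : dom i p -> rep i f (cmap i p) = f p.
Proof.
move=> ip; rewrite /rep; case: pselect => [h|[]]; last by exists p.
by case: cid2 => q iq /= E; rewrite (at_inj HA iq ip E).
Qed.

Lemma open_img i : open (img i).
Proof. by have := at_open HA i i; rewrite setIid. Qed.

Arguments open_img : clear implicits.

Lemma img_cmap i p : dom i p -> img i (cmap i p).
Proof. by exists p. Qed.

Lemma differentiable_transition i j p : dom i p -> dom j p ->
  differentiable (rep i (cmap j)) (cmap i p).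
Proof.
by move=> ip jp; have [+ _] := at_smooth HA i j 1%N; apply; exists p.
Qed.

Lemma overlap_nbhs i j p : dom i p -> dom j p ->
  nbhs (cmap i p) (cmap i @` (dom i `&` dom j)).
Proof.
by move=> ip jp; apply: open_nbhs_nbhs; split; [exact: at_open|exists p].
Qed.

Lemma rep_transition i j W (f : T -> W) p : dom i p -> dom j p ->
  \forall z \near cmap i p, rep i f z = rep j f (rep i (cmap j) z).
Proof.
move=> ip jp; have := overlap_nbhs ip jp.
by apply: filterS => _ [q [iq jq] <-]; rewrite !rep_cmap.
Qed.

Lemma derive_transition i j W (f : T -> W) p v : dom i p -> dom j p ->
  differentiable (rep j f) (cmap j p) ->
  'D_v (rep i f) (cmap i p) =
  'D_('D_v (rep i (cmap j)) (cmap i p)) (rep j f) (cmap j p).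
Proof.
move=> ip jp df; rewrite (near_eq_derive _ (rep_transition f ip jp)).
have dt := differentiable_transition ip jp.
have df' : differentiable (rep j f) (rep i (cmap j) (cmap i p)).
  by rewrite (rep_cmap (cmap j) ip).
by rewrite (derive_comp v dt df') (rep_cmap (cmap j) ip).
Qed.

Lemma derive_tangent i j W (f : T -> W) p v : is_tangent p v ->
  dom i p -> dom j p -> differentiable (rep j f) (cmap j p) ->
  'D_(v i) (rep i f) (cmap i p) = 'D_(v j) (rep j f) (cmap j p).
Proof.
move=> [tv _] ip jp df; rewrite (tv i j ip jp); exact: derive_transition.
Qed.

Implicit Types (X Y Z : rawfield A) (f g : T -> R).

Lemma loc_smooth X i : is_vfield X -> smooth (img i) (loc X i).
Proof. by move=> [_ +]; exact. Qed.

Lemma loc_diff X i p : is_vfield X -> dom i p ->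
  differentiable (loc X i) (cmap i p).
Proof. by move=> hX ip; have [+ _] := loc_smooth i hX 1%N; apply; exists p. Qed.

Lemma rep_diff f i p : smooth_fun A f -> dom i p ->
  differentiable (rep i f) (cmap i p).
Proof. by move=> hf ip; have [+ _] := hf 1%N i; apply; exists p. Qed.

Lemma loc_cmap X i p : dom i p -> loc X i (cmap i p) = X p i.
Proof. exact: rep_cmap. Qed.

Lemma vfield_eq X Y : is_vfield X -> is_vfield Y ->
  (forall i p, dom i p -> X p i = Y p i) -> X = Y.
Proof.
move=> [tX _] [tY _] XY; apply/funext => p; apply/funext => i.
have [ip|nip] := pselect (dom i p); first exact: XY.
by rewrite (tX p).2 // (tY p).2.
Qed.

Lemma vfield0 : is_vfield (0 : rawfield A).
Proof.
split=> [p|i k]; first by split=> // i j _ _; rewrite derive0.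
apply: (Ck_ext (open_img i) _ (Ck_cst (open_img i) k (0 : 'rV[R]_n))) => z _.
by rewrite /rep; case: pselect.
Qed.

Lemma vfieldD X Y : is_vfield X -> is_vfield Y -> is_vfield (X + Y).
Proof.
move=> hX hY; split=> [p|i k].
  have [tX nX] := hX.1 p; have [tY nY] := hY.1 p.
  split=> [i j ip jp|i nip].
    rewrite -[LHS]/(X p j + Y p j) (tX i j ip jp) (tY i j ip jp) -deriveDl //.
    exact: differentiable_transition.
  by rewrite -[LHS]/(X p i + Y p i) nX // nY // addr0.
have -> : rep i (fun p => (X + Y) p i) = fun z => loc X i z + loc Y i z.
  by rewrite -(rep_comp2 i (L := +%R)) ?addr0.
by apply: CkD; [exact: open_img|exact: loc_smooth|exact: loc_smooth].
Qed.

Lemma vfield_scale f X : smooth_fun A f -> is_vfield X ->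
  is_vfield (scale_field f X).
Proof.
move=> hf hX; split=> [p|i k].
  have [tX nX] := hX.1 p; split=> [i j ip jp|i nip].
    rewrite /scale_field (tX i j ip jp) deriveZl //.
    exact: differentiable_transition.
  by rewrite /scale_field nX // scaler0.
have -> : rep i (fun p => scale_field f X p i) = fun z => rep i f z *: loc X i z.
  by apply: (@rep_comp2 i R 'rV[R]_n 'rV[R]_n *:%R f); rewrite scaler0.
by apply: Ck_scale; [exact: open_img|exact: hf|exact: loc_smooth].
Qed.

Lemma smooth_fun_cst c : smooth_fun A (fun=> c).
Proof.
move=> k i; apply: Ck_ext (Ck_cst (open_img i) k c); first exact: open_img.
by move=> _ [p ip <-]; rewrite rep_cmap.
Qed.

Lemma vfieldZ c X : is_vfield X -> is_vfield (c *: X).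
Proof. exact: vfield_scale (smooth_fun_cst c). Qed.

Lemma lie_funE X f i p : is_vfield X -> smooth_fun A f -> dom i p ->
  lie_fun X f p = 'D_(X p i) (rep i f) (cmap i p).
Proof.
move=> [tX _] hf ip; apply: derive_tangent (tX p) _ ip (rep_diff hf ip).
exact: at_cover.
Qed.

Lemma rep_lie_fun X f i z : is_vfield X -> smooth_fun A f -> img i z ->
  rep i (lie_fun X f) z = 'D_(loc X i z) (rep i f) z.
Proof. by move=> hX hf [p ip <-]; rewrite rep_cmap // (lie_funE hX hf ip) loc_cmap. Qed.

Lemma lie_fun_smooth X f : is_vfield X -> smooth_fun A f ->
  smooth_fun A (lie_fun X f).
Proof.
move=> hX hf k i.
have C := Ck_derive_along (open_img i) (loc_smooth i hX k) (hf k.+1 i).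
by apply: Ck_ext (open_img i) _ C => z iz; rewrite -rep_lie_fun.
Qed.

Lemma loc_bracket X Y i z : img i z ->
  loc (bracket X Y) i z = 'D_(loc X i z) (loc Y i) z - 'D_(loc Y i z) (loc X i) z.
Proof. by move=> [p ip <-]; rewrite !loc_cmap. Qed.

Lemma lie_funDr X f g : smooth_fun A f -> smooth_fun A g ->
  lie_fun X (fun p => f p + g p) = fun p => lie_fun X f p + lie_fun X g p.
Proof.
move=> hf hg; apply/funext => p; have ip := at_cover HA p.
rewrite /lie_fun (@rep_comp2 _ R R R +%R f) ?addr0 //=.
by apply: deriveD; apply: diff_derivable; exact: rep_diff.
Qed.

Lemma lie_funDl X Y f : smooth_fun A f ->
  lie_fun (X + Y) f = fun p => lie_fun X f p + lie_fun Y f p.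
Proof.
move=> hf; apply/funext => p; have ip := at_cover HA p.
by apply: deriveDl; exact: rep_diff.
Qed.

Lemma bracket_anti X Y : bracket X Y = - bracket Y X.
Proof. by apply/funext => p; apply/funext => i; rewrite -[RHS]/(- (_ - _)) opprB. Qed.

Lemma bracket_off X Y i p : is_vfield X -> is_vfield Y -> ~ dom i p ->
  bracket X Y p i = 0.
Proof.
by move=> [tX _] [tY _] nip; rewrite /bracket (tX p).2 // (tY p).2 // !derive0 subrr.
Qed.

(** The change of components holds near the point and can be differentiated
there. *)
Lemma field_transition X i j p : is_vfield X -> dom i p -> dom j p ->
  \forall z \near cmap i p,
    loc X j (rep i (cmap j) z) = 'D_(loc X i z) (rep i (cmap j)) z.
Proof.
move=> hX ip jp; have := overlap_nbhs ip jp.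
apply: filterS => _ [q [iq jq] <-]; rewrite rep_cmap // !loc_cmap //.
exact: (hX.1 q).1.
Qed.

Lemma derive_field_transition X Y i j p : is_vfield X -> is_vfield Y ->
  dom i p -> dom j p ->
  'D_(X p j) (loc Y j) (cmap j p) =
  'D_(X p i) (fun z => 'D_(loc Y i z) (rep i (cmap j)) z) (cmap i p).
Proof.
move=> hX hY ip jp; rewrite -(near_eq_derive _ (field_transition hY ip jp)).
have dt := differentiable_transition ip jp.
have dY : differentiable (loc Y j) (rep i (cmap j) (cmap i p)).
  by rewrite (rep_cmap (cmap j) ip); exact: loc_diff.
by rewrite ((hX.1 p).1 i j ip jp) (derive_comp _ dt dY) (rep_cmap (cmap j) ip).
Qed.

(** Changing charts, the bracket picks up second derivatives of the transition
map, which cancel by symmetry. *)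
Lemma vfield_bracket X Y : is_vfield X -> is_vfield Y ->
  is_vfield (bracket X Y).
Proof.
move=> hX hY; split=> [p|i k].
  split=> [i j ip jp|i nip]; last exact: bracket_off.
  have Ux : (cmap i @` (dom i `&` dom j)) (cmap i p) by exists p.
  have oU := at_open HA i j; have Cphi := at_smooth HA i j 2.
  have sc u v := schwarz u v oU Ux Cphi.
  have := derive_commutator oU Ux (loc_diff hX ip) (loc_diff hY ip) Cphi sc.
  rewrite (loc_cmap X ip) (loc_cmap Y ip) => E; apply: etrans (esym E).
  exact: congr2 (derive_field_transition hX hY ip jp)
    (congr1 -%R (derive_field_transition hY hX ip jp)).
have CXY := Ck_derive_along (open_img i) (loc_smooth i hX k) (loc_smooth i hY k.+1).
have CYX := Ck_derive_along (open_img i) (loc_smooth i hY k) (loc_smooth i hX k.+1).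
have C := CkD (open_img i) CXY (Ck_scale (open_img i) (Ck_cst (open_img i) k (-1 : R)) CYX).
apply: Ck_ext (open_img i) _ C => z iz.
by rewrite -/(loc (bracket X Y) i) loc_bracket // scaleN1r.
Qed.

Lemma lie_fun_bracket X Y f : is_vfield X -> is_vfield Y -> smooth_fun A f ->
  lie_fun (bracket X Y) f =
  fun p => lie_fun X (lie_fun Y f) p - lie_fun Y (lie_fun X f) p.
Proof.
move=> hX hY hf; apply/funext => p; have ip := at_cover HA p.
set i := chart_at A p in ip *; have oi := open_img i; have Ux := img_cmap ip.
have sc u v := schwarz_real u v oi Ux (hf 2 i).
have := derive_commutator oi Ux (loc_diff hX ip) (loc_diff hY ip) (hf 2 i) sc.
rewrite (loc_cmap X ip) (loc_cmap Y ip) => E; apply: etrans E _.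
by congr (_ - _); apply: open_eq_derive oi Ux _ => z iz; rewrite -rep_lie_fun.
Qed.

Lemma bracketDl X Y Z : is_vfield X -> is_vfield Y -> is_vfield Z ->
  bracket (X + Y) Z = bracket X Z + bracket Y Z.
Proof.
move=> hX hY hZ; have hXY := vfieldD hX hY.
apply: vfield_eq; first exact: vfield_bracket.
  by apply: vfieldD; exact: vfield_bracket.
move=> i p ip; rewrite -[RHS]/(bracket X Z p i + bracket Y Z p i) /bracket.
rewrite -!/(loc _ i) -[(X + Y) p i]/(X p i + Y p i).
have -> : loc (X + Y) i = loc X i + loc Y i.
  by rewrite [LHS](rep_comp2 i (L := +%R)) ?addr0.
rewrite (deriveDl (loc_diff hZ ip)).
rewrite deriveD; [abel|exact/diff_derivable/loc_diff..].
Qed.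

(** In a chart each double bracket is a sum of four terms [d X Y Z], the
derivative of [Z] along [Y] and then along [X], by the commutator formula applied
to the components of the fields; these cancel. *)
Lemma bracket_jacobi X Y Z : is_vfield X -> is_vfield Y -> is_vfield Z ->
  bracket X (bracket Y Z) + bracket Y (bracket Z X) + bracket Z (bracket X Y) = 0.
Proof.
move=> hX hY hZ.
have hb X' Y' Z' : is_vfield X' -> is_vfield Y' -> is_vfield Z' ->
  is_vfield (bracket X' (bracket Y' Z')).
  by move=> *; do 2!apply: vfield_bracket => //.
apply: vfield_eq; first by apply: vfieldD; [apply: vfieldD|]; exact: hb.
  exact: vfield0.
move=> i p ip; have oi := open_img i; have Ux := img_cmap ip; set x := cmap i p.
pose d X' Y' Z' := 'D_(X' p i) (fun z => 'D_(loc Y' i z) (loc Z' i) z) x.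
have E X' Y' Z' : is_vfield X' -> is_vfield Y' -> is_vfield Z' ->
    bracket X' (bracket Y' Z') p i =
    d X' Y' Z' - d X' Z' Y' - (d Y' Z' X' - d Z' Y' X').
  move=> h1 h2 h3; have C2 := loc_smooth i h1 2.
  have sc u v := schwarz u v oi Ux C2.
  have := derive_commutator oi Ux (loc_diff h2 ip) (loc_diff h3 ip) C2 sc.
  rewrite (loc_cmap Y' ip) (loc_cmap Z' ip) => H.
  congr (_ - _); last exact: H.
  have dd Z1 Z2 : is_vfield Z1 -> is_vfield Z2 ->
      derivable (fun z => 'D_(loc Z1 i z) (loc Z2 i) z) x (X' p i).
    move=> g1 g2; apply: diff_derivable.
    have [+ _] := Ck_derive_along oi (loc_smooth i g1 1%N) (loc_smooth i g2 2).
    by apply.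
  apply: etrans (deriveB (dd _ _ h2 h3) (dd _ _ h3 h2)).
  by apply: open_eq_derive oi Ux _ => z iz; exact: loc_bracket.
rewrite -[RHS]/(0 : 'rV[R]_n).
rewrite -[LHS]/(bracket X (bracket Y Z) p i + bracket Y (bracket Z X) p i
  + bracket Z (bracket X Y) p i).
rewrite (E X Y Z) // (E Y Z X) // (E Z X Y) //.
move: (d X Y Z) (d X Z Y) (d Y Z X) (d Y X Z) (d Z X Y) (d Z Y X) => *; abel.
Qed.

End Rep.

Arguments open_img {R T n A} HA i.

(** * Charts of the slit tangent bundle *)

Lemma manifold_is_atlas (R : realType) n (M : manifold R n) : is_atlas (atlas M).
Proof.
split.
- exact: dom_cover.
- exact: cmap_inj.
- move=> i j; apply: cmap_open; last by move=> p [].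
  by apply: openI; exact: dom_open.
- exact: transition_smooth.
Qed.

Section LinearMaps.
Variables (R : realType) (V : normedModType R).

Lemma continuous_mulmxr m p (N : 'M[R]_(m, p)) :
  continuous (fun w : 'rV[R]_m => w *m N).
Proof. exact: (@linear_rV_continuous R m 'rV[R]_p (mulmxr N)). Qed.

Lemma derive_mulmxr m p (N : 'M[R]_(m, p)) (f : V -> 'rV[R]_m) x v :
  differentiable f x -> 'D_v (fun z => f z *m N) x = 'D_v f x *m N.
Proof.
move=> df.
have E := (@derive_linear_comp R V 'rV[R]_m 'rV[R]_p (mulmxr N) f x v (@continuous_mulmxr _ _ N) df).
exact: E.
Qed.

Lemma Ck_mulmxr m p (N : 'M[R]_(m, p)) U k (f : V -> 'rV[R]_m) :
  open U -> Ck k U f -> Ck k U (fun z => f z *m N).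
Proof.
by move=> oU; apply: (@Ck_linear R V _ U oU k _ (mulmxr N)); exact: continuous_mulmxr.
Qed.

Lemma Ck_id (U : set V) k : open U -> Ck k U id.
Proof.
move=> oU; case: k => [x _|k]; first exact: cvg_id.
split=> [//|v]; apply: Ck_ext oU _ (Ck_cst oU k v) => z _.
by rewrite derive_id.
Qed.

End LinearMaps.

(** Matrices acting on row vectors [(x, y)]: the vertical endomorphism is
[(x, y) |-> (0, x)], the Liouville field in a chart is [(x, y) |-> (0, y)], and
[(x, y) |-> (y, 0)] writes [D_y phi x] as a derivative of [phi \o lsubmx] in a
direction that depends linearly on the point. *)
Section Blocks.
Variables (R : realType) (n : nat).

Definition vert : 'M[R]_(n + n) := block_mx 0 1%:M 0 0.
Definition horiz : 'M[R]_(n + n) := block_mx 0 0 1%:M 0.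
Definition fiber : 'M[R]_(n + n) := block_mx 0 0 0 1%:M.

Lemma mul_vert (w : 'rV[R]_(n + n)) : w *m vert = row_mx 0 (lsubmx w).
Proof.
by rewrite -[in LHS](hsubmxK w) mul_row_block !mulmx0 mulmx1 !addr0.
Qed.

Lemma mul_horiz (w : 'rV[R]_(n + n)) : w *m horiz = row_mx (rsubmx w) 0.
Proof.
by rewrite -[in LHS](hsubmxK w) mul_row_block !mulmx0 mulmx1 !add0r.
Qed.

Lemma mul_fiber (w : 'rV[R]_(n + n)) : w *m fiber = row_mx 0 (rsubmx w).
Proof.
by rewrite -[in LHS](hsubmxK w) mul_row_block !mulmx0 mulmx1 !add0r.
Qed.

End Blocks.

Section TangentTransition.
Variables (R : realType) (n : nat) (U : set 'rV[R]_n) (phi : 'rV[R]_n -> 'rV[R]_n).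
Hypotheses (oU : open U) (Cphi : smooth U phi).

(** The transition map of the tangent bundle induced by a transition map
[phi]. *)
Definition tangent_map (w : 'rV[R]_(n + n)) : 'rV[R]_(n + n) :=
  row_mx (phi (lsubmx w)) ('D_(rsubmx w) phi (lsubmx w)).

Let TU : set 'rV[R]_(n + n) := lsubmx @^-1` U.

Let lsub_cont : continuous (lsubmx : 'rV[R]_(n + n) -> 'rV[R]_n).
Proof. exact: continuous_lsubmx. Qed.

Lemma open_tangent_dom : open TU.
Proof. by apply: open_comp => // z _; exact: lsub_cont. Qed.

Let f (w : 'rV[R]_(n + n)) := phi (lsubmx w).

Let Cf : smooth TU f.
Proof.
move=> k.
exact: (@Ck_precomp R _ _ _ lsubmx TU U k phi open_tangent_dom lsub_cont _ (Cphi k)).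
Qed.

Let derive_f v w : TU w -> 'D_v f w = 'D_(lsubmx v) phi (lsubmx w).
Proof.
move=> Tw; have [dphi _] := Cphi 1.
have dl : differentiable (lsubmx : 'rV[R]_(n + n) -> 'rV[R]_n) w.
  exact: differentiable_lsubmx.
rewrite [LHS](derive_comp v dl (dphi _ Tw)); congr ('D__ _ _).
by rewrite (@derive_linear_comp R _ _ _ lsubmx id w v lsub_cont) ?derive_id.
Qed.

Let derive_along_f w : TU w ->
  'D_(rsubmx w) phi (lsubmx w) = 'D_(w *m horiz R n) f w.
Proof. by move=> Tw; rewrite (derive_f _ Tw) mul_horiz row_mxKl. Qed.

Let tangent_mapE w : TU w -> tangent_map w =
  f w *m row_mx 1%:M 0 + 'D_(w *m horiz R n) f w *m row_mx 0 1%:M.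
Proof.
move=> Tw; rewrite -derive_along_f // !mul_mx_row !mulmx1 !mulmx0 add_row_mx.
by rewrite addr0 add0r.
Qed.

Lemma tangent_map_smooth : smooth TU tangent_map.
Proof.
have oT := open_tangent_dom => k.
have C1 := Ck_mulmxr (row_mx 1%:M (0 : 'M_n)) oT (Cf k).
have Ch := Ck_mulmxr (horiz R n) oT (Ck_id k oT).
have C2 := Ck_mulmxr (row_mx (0 : 'M_n) 1%:M) oT (Ck_derive_along oT Ch (Cf k.+1)).
by apply: (Ck_ext oT _ (CkD oT C1 C2)) => w Tw; rewrite tangent_mapE.
Qed.

Let diff_tangent_map w : TU w -> differentiable tangent_map w.
Proof. by move=> Tw; have [+ _] := tangent_map_smooth 1; apply. Qed.

Lemma lsubmx_derive_tangent_map a w : TU w ->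
  lsubmx ('D_a tangent_map w) = 'D_(lsubmx a) phi (lsubmx w).
Proof.
move=> Tw; rewrite -derive_f //.
rewrite -(@derive_linear_comp R _ _ _ lsubmx _ w a lsub_cont); last exact: diff_tangent_map.
have -> // : (fun z => lsubmx (tangent_map z)) = f.
by apply/funext => z; exact: row_mxKl.
Qed.

(** [D_y phi x] is linear in [y].  In the computation below the derivative has
two terms; the second one differentiates [D_y phi x], [y] fixed, in a direction
where [x] is constant. *)
Lemma derive_tangent_map_vertical b w : TU w ->
  'D_(row_mx 0 b) tangent_map w = row_mx 0 ('D_b phi (lsubmx w)).
Proof.
move=> Tw; have oT := open_tangent_dom.
rewrite -[LHS]hsubmxK lsubmx_derive_tangent_map // row_mxKl derive0; congr row_mx.
have rc : continuous (rsubmx : 'rV[R]_(n + n) -> 'rV[R]_n) by exact: continuous_rsubmx.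
rewrite -(@derive_linear_comp R _ _ _ rsubmx _ w _ rc); last exact: diff_tangent_map.
have E z : TU z -> rsubmx (tangent_map z) = 'D_(z *m horiz R n) f z.
  by move=> Tz; rewrite row_mxKr derive_along_f.
rewrite (open_eq_derive _ oT Tw E).
have dh : differentiable (fun z => z *m horiz R n) w.
  exact: (@linear_differentiable R 'rV[R]_(n + n) 'rV[R]_(n + n) (mulmxr (horiz R n)) w
    (@continuous_mulmxr _ _ _ _)).
rewrite (derive_derive_along oT _ Tw dh (Cf 2)).
have Dh v : 'D_v (fun z => z *m horiz R n) w = v *m horiz R n.
  by rewrite (derive_mulmxr (horiz R n) v (f := id)) // derive_id.
rewrite Dh derive_f // (mul_horiz (row_mx 0 b)) row_mxKl row_mxKr.
suff -> : 'D_(row_mx 0 b) ('D_(w *m horiz R n) f) w = 0 by rewrite addr0.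
have [_ C1] := Cphi 2; have [dd _] := C1 (rsubmx w).
have Eg z : TU z -> 'D_(w *m horiz R n) f z = 'D_(rsubmx w) phi (lsubmx z).
  by move=> Tz; rewrite (derive_f _ Tz) mul_horiz row_mxKl.
rewrite (open_eq_derive _ oT Tw Eg).
have dl : differentiable (lsubmx : 'rV[R]_(n + n) -> 'rV[R]_n) w.
  exact: differentiable_lsubmx.
rewrite (derive_comp _ dl (dd _ Tw)).
rewrite (@derive_linear_comp R _ _ _ lsubmx id w _ lsub_cont) ?derive_id //.
by rewrite -[X in 'D_X _ _]/(lsubmx (row_mx 0 b)) row_mxKl derive0.
Qed.

End TangentTransition.

Lemma Ck_sub (R : realType) (V W : normedModType R) (U U' : set V) k
    (f : V -> W) : U' `<=` U -> Ck k U f -> Ck k U' f.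
Proof.
move=> U'U; elim: k f => [|k IH] f; first by move=> cf x /U'U; exact: cf.
by move=> [df Cf]; split=> [x /U'U|v]; [exact: df|exact: IH (Cf v)].
Qed.

Section SlitBundle.
Variables (R : realType) (n : nat) (M : manifold R n).

Let A := atlas M.
Let HA : is_atlas A := manifold_is_atlas M.
Local Notation SA := (slit_charts M).
Local Notation field := (rawfield (slit_charts M)).
Implicit Types (u : slit_bundle M) (i j : idx A).

Let base u : M := tbase (sval u).
Let comp u : idx A -> 'rV[R]_n := tcomp (sval u).

(** The tangent vector at [p] with component [y] in the chart [i].  It shows that
every pair [(x, y)] over a chart comes from a vector, so that the image of an
induced chart is a full product ([slit_overlap]). *)
Definition tangent_family (p : M) i (y : 'rV[R]_n) : idx A -> 'rV[R]_n :=
  fun j => if pselect (dom j p) is left _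
           then 'D_y (rep i (cmap j)) (cmap i p) else 0.

Lemma tangent_familyP p i y : dom i p -> is_tangent p (tangent_family p i y).
Proof.
move=> ip; split=> [j k jp kp|j nj]; rewrite /tangent_family.
  case: pselect => [_|/(_ kp) []]; case: pselect => [_|/(_ jp) []].
  apply: (derive_transition HA y ip jp).
  exact: (differentiable_transition HA jp kp).
by case: pselect.
Qed.

Lemma tangent_family_id p i y : dom i p -> tangent_family p i y i = y.
Proof.
move=> ip; rewrite /tangent_family; case: pselect => // _.
have E z : img i z -> rep i (cmap i) z = z.
  by move=> [q iq <-]; rewrite (rep_cmap HA).
rewrite (open_eq_derive _ (open_img HA i) (img_cmap ip) E).
exact: derive_id.
Qed.

Lemma tangent_eq (v w : tangent_bundle M) i : tbase v = tbase w ->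
  dom i (tbase v) -> tcomp v i = tcomp w i -> v = w.
Proof.
case: v w => [p v tv] [q w tw] /= pq ip vw; subst q.
suff vwE : v = w by subst w; congr TangentVector; exact: Prop_irrelevance.
apply/funext => j; have [jp|nj] := pselect (dom j p).
  by rewrite (tv.1 i j ip jp) (tw.1 i j ip jp) vw.
by rewrite tv.2 // tw.2.
Qed.

(** A nonzero vector has nonzero components in every chart at its base point,
as the components in one chart determine the others. *)
Lemma comp_neq0 u i : dom i (base u) -> comp u i != 0.
Proof.
move=> iu; apply/eqP => u0; apply: (svalP u); apply/funext => j.
have [tu nu] := tangentP (sval u).
have [ju|nj] := pselect (dom j (base u)); last exact: nu.
by rewrite (tu i j) // -/(comp u i) u0 derive0.
Qed.

Lemma slit_vector p i y : dom i p -> y != 0 ->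
  exists u, base u = p /\ comp u i = y.
Proof.
move=> ip y0; pose v := TangentVector (tangent_familyP y ip).
have v0 : tcomp v <> 0.
  by move=> /(congr1 (@^~ i)) /= E; move: y0; rewrite -(tangent_family_id y ip) E eqxx.
by exists (exist _ v v0); rewrite /comp /= tangent_family_id.
Qed.

Definition overlap i j : set 'rV[R]_n := cmap i @` (dom i `&` dom j).

Lemma slit_overlap i j :
  cmap (c := SA) i @` (dom (c := SA) i `&` dom (c := SA) j) =
  (lsubmx @^-1` overlap i j) `&` (rsubmx @^-1` [set y | y != 0]).
Proof.
apply/seteqP; split=> [w [u [iu ju] <-]|w [/= [p [ip jp] pw] w0]].
  rewrite /= row_mxKl row_mxKr; split; last exact: comp_neq0.
  by exists (base u).
have [u [up uw]] := slit_vector ip w0.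
exists u; first by rewrite /= -!/(base u) up.
by rewrite /= -/(base u) -/(comp u i) up uw pw hsubmxK.
Qed.

Lemma slit_inj i u v : dom (c := SA) i u -> dom (c := SA) i v ->
  cmap (c := SA) i u = cmap (c := SA) i v -> u = v.
Proof.
move=> iu iv /= /eq_row_mx[Eb Ec].
have uv : sval u = sval v by apply: tangent_eq (iu) Ec; exact: cmap_inj Eb.
case: u v uv {iu iv Eb Ec} => [u u0] [v v0] /= uv; subst v.
by congr exist; exact: Prop_irrelevance.
Qed.

Lemma rep_slit_cmap (W : normedModType R) (f : slit_bundle M -> W) i u :
  dom (c := SA) i u -> rep (A := SA) i f (cmap (c := SA) i u) = f u.
Proof.
move=> iu; rewrite /rep; case: pselect => [h|[]]; last by exists u.
by case: cid2 => v iv E; congr f; exact: slit_inj iv iu E.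
Qed.

Lemma slit_transition i j u :
  dom (c := SA) i u -> dom (c := SA) j u ->
  cmap (c := SA) j u = tangent_map (rep i (cmap j)) (cmap (c := SA) i u).
Proof.
move=> iu ju; rewrite /tangent_map /= row_mxKl row_mxKr (rep_cmap HA) //.
by congr row_mx; exact: (tangentP (sval u)).1.
Qed.

Lemma open_slit_overlap i j :
  open (cmap (c := SA) i @` (dom (c := SA) i `&` dom (c := SA) j)).
Proof.
rewrite slit_overlap; apply: openI.
  apply: open_tangent_dom; exact: (at_open HA i j).
apply: open_comp; first by move=> *; exact: continuous_rsubmx.
have -> : [set y : 'rV[R]_n | y != 0] = ~` [set 0].
  by apply/seteqP; split=> y /= /eqP.
apply: closed_openC; apply: accessible_closed_set1.
exact: hausdorff_accessible (@norm_hausdorff _ _).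
Qed.

Arguments open_slit_overlap : clear implicits.

Lemma slit_is_atlas : is_atlas SA.
Proof.
split.
- by move=> u; exact: at_cover HA _.
- exact: slit_inj.
- exact: open_slit_overlap.
- move=> i j k.
  have C := tangent_map_smooth (at_open HA i j) (at_smooth HA i j) k.
  have C' : Ck k (cmap (c := SA) i @` (dom (c := SA) i `&` dom (c := SA) j))
      (tangent_map (rep (A := A) i (cmap (c := A) j))).
    rewrite slit_overlap.
    by apply: Ck_sub C => w [].
  apply: (Ck_ext (open_slit_overlap i j) _ C').
  by move=> _ [u [iu ju] <-]; rewrite -slit_transition // rep_slit_cmap.
Qed.

End SlitBundle.

(** * The vertical endomorphism and the Liouville field *)

Section VerticalEndomorphism.
Variables (R : realType) (n : nat) (M : manifold R n).
Local Notation SA := (slit_charts M).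
Local Notation field := (rawfield (slit_charts M)).
Implicit Types (u : slit_bundle M) (i j : idx SA) (X Y S : field).

Let HS : is_atlas SA := slit_is_atlas M.

Lemma JE X u i : J X u i = X u i *m vert R n.
Proof. by rewrite mul_vert. Qed.

Lemma LiouvilleE u i : @Liouville R n M u i = cmap i u *m fiber R n.
Proof. by rewrite mul_fiber row_mxKr. Qed.

Lemma derive_slit_transition i j u a : dom i u -> dom j u ->
  'D_a (rep i (cmap j)) (cmap i u) =
  'D_a (tangent_map (rep (A := atlas M) i (cmap (c := atlas M) j))) (cmap i u).
Proof.
move=> iu ju; apply: near_eq_derive; have := overlap_nbhs HS iu ju.
by apply: filterS => _ [v [iv jv] <-]; rewrite (rep_cmap HS) //; exact: slit_transition.
Qed.

Lemma vertical_transition i j u b : dom i u -> dom j u ->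
  'D_(row_mx 0 b) (rep i (cmap j)) (cmap i u) =
  row_mx 0 ('D_b (rep (A := atlas M) i (cmap (c := atlas M) j))
                 (cmap (c := atlas M) i (tbase (sval u)))).
Proof.
move=> iu ju; rewrite derive_slit_transition //.
have HM := manifold_is_atlas M.
rewrite (derive_tangent_map_vertical (at_open HM i j) (at_smooth HM i j)).
  by rewrite row_mxKl.
by rewrite /= row_mxKl; exists (tbase (sval u)).
Qed.

Lemma vfield_J X : is_vfield X -> is_vfield (J X).
Proof.
move=> hX; split=> [u|i k].
  have [tX nX] := hX.1 u; split=> [i j iu ju|i ni]; last first.
    by rewrite JE nX // mul0mx.
  rewrite /J vertical_transition //; congr row_mx.
  rewrite (tX i j iu ju) derive_slit_transition //.
  have HM := manifold_is_atlas M.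
  rewrite (lsubmx_derive_tangent_map (at_open HM i j) (at_smooth HM i j)).
    by rewrite row_mxKl.
  by rewrite /= row_mxKl; exists (tbase (sval u)).
have C := Ck_mulmxr (vert R n) (open_img HS i) (loc_smooth i hX k).
apply: (Ck_ext (open_img HS i) _ C) => _ [u iu <-].
by rewrite loc_cmap // (rep_cmap HS) // JE.
Qed.

Lemma vfield_Liouville : is_vfield (@Liouville R n M).
Proof.
split=> [u|i k].
  have [tu nu] := tangentP (sval u); split=> [i j iu ju|i ni]; last first.
    by rewrite /Liouville nu // row_mx0.
  rewrite /Liouville vertical_transition //; congr row_mx; exact: tu.
have oi := open_img HS i.
have C := Ck_mulmxr (fiber R n) oi (Ck_id k oi).
apply: (Ck_ext oi _ C) => _ [u iu <-].
by rewrite (rep_cmap HS) // LiouvilleE.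
Qed.

(** In induced charts [J] is multiplication by a constant matrix, so it commutes
with derivatives of components. *)
Lemma derive_loc_J X i u v : is_vfield X -> dom i u ->
  'D_v (loc (J X) i) (cmap i u) = 'D_v (loc X i) (cmap i u) *m vert R n.
Proof.
move=> hX iu; rewrite -(derive_mulmxr (vert R n) v (loc_diff hX iu)).
apply: (open_eq_derive _ (open_img HS i) (img_cmap iu)) => _ [w iw <-].
by rewrite !(loc_cmap HS) // JE.
Qed.

Lemma derive_loc_Liouville i u v : dom i u ->
  'D_v (loc (@Liouville R n M) i) (cmap i u) = v *m fiber R n.
Proof.
move=> iu.
have E : 'D_v (fun z : 'rV[R]_(n + n) => z *m fiber R n) (cmap i u) = v *m fiber R n.
  by rewrite (derive_mulmxr (fiber R n) v (f := id)) // derive_id.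
apply: etrans E.
apply: (open_eq_derive _ (open_img HS i) (img_cmap iu)) => _ [w iw <-].
by rewrite (loc_cmap HS) // LiouvilleE.
Qed.

Lemma bracketE X Y u i : bracket X Y u i =
  'D_(X u i) (loc Y i) (cmap i u) - 'D_(Y u i) (loc X i) (cmap i u).
Proof. by []. Qed.

Lemma vert_vert : vert R n *m vert R n = 0.
Proof. by rewrite mulmx_block !mul0mx !mulmx0 !addr0 block_mx0. Qed.

Lemma vert_fiber : vert R n *m fiber R n = vert R n.
Proof. by rewrite mulmx_block !mul0mx !mulmx0 mulmx1 !add0r. Qed.

Lemma fiber_vert : fiber R n *m vert R n = 0.
Proof. by rewrite mulmx_block !mul0mx !mulmx0 !addr0 block_mx0. Qed.

Lemma JJ X : J (J X) = 0.
Proof.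
by apply/funext => u; apply/funext => i; rewrite !JE -mulmxA vert_vert mulmx0.
Qed.

Lemma JD X Y : J (X + Y) = J X + J Y.
Proof.
by apply/funext => u; apply/funext => i; rewrite JE mulmxDl -!JE.
Qed.

(** The Nijenhuis tensor of [J] vanishes, as [J] has constant coefficients in
induced charts and [J \o J = 0]. *)
Lemma J_nijenhuis X Y : is_vfield X -> is_vfield Y ->
  bracket (J X) (J Y) = J (bracket (J X) Y) + J (bracket X (J Y)).
Proof.
move=> hX hY; have hJX := vfield_J hX; have hJY := vfield_J hY.
apply: (vfield_eq (vfield_bracket HS hJX hJY)).
  by apply: (vfieldD HS); apply: vfield_J; exact: (vfield_bracket HS).
move=> i u iu.
transitivity ('D_(J X u i) (loc Y i) (cmap i u) *m vert R n -
              'D_(J Y u i) (loc X i) (cmap i u) *m vert R n).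
  by rewrite bracketE (derive_loc_J _ hX iu) (derive_loc_J _ hY iu).
(* The terms in c and d are killed by the square of the matrix. *)
have alg (a b c d : 'rV[R]_(n + n)) : a *m vert R n - b *m vert R n =
    (a - c *m vert R n) *m vert R n + (d *m vert R n - b) *m vert R n.
  by rewrite !mulmxBl -!mulmxA vert_vert !mulmx0 subr0 sub0r.
apply: etrans (alg _ _ ('D_(Y u i) (loc X i) (cmap i u))
                       ('D_(X u i) (loc Y i) (cmap i u))) _.
rewrite -(derive_loc_J _ hX iu) -(derive_loc_J _ hY iu).
exact: (congr2 +%R (esym (JE (bracket (J X) Y) u i))
                   (esym (JE (bracket X (J Y)) u i))).
Qed.

(** [J] is homogeneous of degree 0 in [y]: [[C, J] = - J]. *)
Lemma Liouville_J X : is_vfield X ->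
  bracket (@Liouville R n M) (J X) = J (bracket (@Liouville R n M) X) - J X.
Proof.
move=> hX; have hJX := vfield_J hX; have hC := vfield_Liouville.
have hb := vfield_bracket HS hC hX.
apply: (vfield_eq (vfield_bracket HS hC hJX)).
  by rewrite -scaleN1r; apply: (vfieldD HS); [|apply: (vfieldZ HS)]; exact: vfield_J.
move=> i u iu.
rewrite -[RHS]/(J (bracket (@Liouville R n M) X) u i - J X u i) !JE /bracket.
rewrite -!/(loc _ i) derive_loc_J // !derive_loc_Liouville // mulmxBl -!mulmxA.
by rewrite JE -mulmxA vert_fiber fiber_vert mulmx0 subr0.
Qed.

(** [J[X,S] = D_X (JS)] for vertical [X], since [J] has constant coefficients;
and [D_X C = X] because [C] is the identity on fibers. *)
Lemma semispray_lift X S : is_vfield X -> is_vfield S -> J X = 0 ->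
  J S = @Liouville R n M -> J (bracket X S) = X.
Proof.
move=> hX hS JX JS; have hb := vfield_bracket HS hX hS.
apply: (vfield_eq (vfield_J hb) hX) => i u iu.
rewrite JE /bracket -!/(loc _ i) mulmxBl -!derive_loc_J // JX JS.
rewrite derive_loc_Liouville //.
rewrite (_ : loc 0 i = fun=> 0); last first.
  by apply/funext => z; rewrite /loc /rep; case: pselect.
rewrite derive_cst subr0 mul_fiber -[RHS]hsubmxK; congr row_mx.
have : J X u i = 0 by rewrite JX.
by rewrite /J => /(congr1 rsubmx); rewrite row_mxKr => ->; rewrite linear0.
Qed.

End VerticalEndomorphism.

(** * Bianchi identities of a connection with torsion *)

Section AdditiveMaps.
Variables (V W : zmodType) (f : V -> W).
Hypothesis fD : forall x y, f (x + y) = f x + f y.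

Lemma map0 : f 0 = 0.
Proof. by apply: (addrI (f 0)); rewrite -fD !addr0. Qed.

Lemma mapN x : f (- x) = - f x.
Proof. by apply/eqP; rewrite -addr_eq0 -fD addNr map0. Qed.

End AdditiveMaps.

(** Additive maps commute with halving; thus the projectors [h] and [v] pass
through maps that are only known to be additive. *)
Lemma map_half (R : numFieldType) (V W : lmodType R) (f : V -> W) x :
  (forall x y, f (x + y) = f x + f y) -> f (2^-1 *: x) = 2^-1 *: f x.
Proof.
move=> fD; have half (U : lmodType R) (y : U) : 2^-1 *: y + 2^-1 *: y = y.
  by rewrite -scalerDl -[X in _ = X]scale1r; congr (_ *: _); field.
by rewrite -{2}(half _ x) fD scalerDr half.
Qed.

(** [V] stands for the vector fields with their Lie bracket [br], and [D] for a
connection on them. *)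
Section Bianchi.
Variables (V : zmodType) (br D : V -> V -> V).

Definition tors X Y := D X Y - D Y X - br X Y.
Definition curv X Y Z := D X (D Y Z) - D Y (D X Z) - D (br X Y) Z.
Definition nabla2 Z (Q : V -> V -> V) X Y :=
  D Z (Q X Y) - Q (D Z X) Y - Q X (D Z Y).
Definition nabla3 Z (Q : V -> V -> V -> V) X Y W :=
  D Z (Q X Y W) - Q (D Z X) Y W - Q X (D Z Y) W - Q X Y (D Z W).

Hypotheses (brDl : forall X Y Z, br (X + Y) Z = br X Z + br Y Z)
  (br_anti : forall X Y, br X Y = - br Y X)
  (jacobi : forall X Y Z, br X (br Y Z) + br Y (br Z X) + br Z (br X Y) = 0)
  (DDl : forall X Y Z, D (X + Y) Z = D X Z + D Y Z)
  (DDr : forall X Y Z, D X (Y + Z) = D X Y + D X Z).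

Let brDr X Y Z : br X (Y + Z) = br X Y + br X Z.
Proof. by rewrite br_anti brDl opprD -!br_anti. Qed.
Let brNl X Y : br (- X) Y = - br X Y.
Proof. by rewrite (mapN (f := br^~ Y)). Qed.
Let brNr X Y : br X (- Y) = - br X Y.
Proof. by rewrite (mapN (f := br X)). Qed.
Let DNl X Y : D (- X) Y = - D X Y.
Proof. by rewrite (mapN (f := D^~ Y)). Qed.
Let DNr X Y : D X (- Y) = - D X Y.
Proof. by rewrite (mapN (f := D X)). Qed.

Definition lin_rules := (brDl, brDr, brNl, brNr, DDl, DDr, DNl, DNr).

(** Expanding the definitions, everything cancels but the terms in double
brackets, which the Jacobi identity removes. *)
Lemma bianchi1 X Y Z :
  curv X Y Z + curv Y Z X + curv Z X Y =
  nabla2 X tors Y Z + nabla2 Y tors Z X + nabla2 Z tors X Y +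
  (tors (tors X Y) Z + tors (tors Y Z) X + tors (tors Z X) Y).
Proof.
have J3 : br (br X Y) Z = - br (br Y Z) X - br (br Z X) Y.
  rewrite !(br_anti (br _ _)) !opprK.
  by have := jacobi X Y Z => /eqP; rewrite addr_eq0 => /eqP ->.
rewrite /curv /nabla2 /tors !lin_rules J3 (br_anti Y (D _ _)).
rewrite (br_anti X (D _ _)) (br_anti Z (D _ _)); abel.
Qed.

(** The iterated derivatives cancel as in the Jacobi identity of the commutator
of operators; the Jacobi identity of [br] removes the rest. *)
Lemma bianchi2 X Y Z W :
  nabla3 X curv Y Z W + nabla3 Y curv Z X W + nabla3 Z curv X Y W +
  (curv (tors X Y) Z W + curv (tors Y Z) X W + curv (tors Z X) Y W) = 0.
Proof.
have J3 : D (br (br X Y) Z) W = - D (br (br Y Z) X) W - D (br (br Z X) Y) W.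
  have := jacobi X Y Z => /eqP; rewrite addr_eq0 => /eqP E.
  by rewrite (br_anti (br X Y)) -E DDl (br_anti X (br _ _)) (br_anti Y (br _ _)) !DNl.
rewrite /nabla3 /curv /tors !lin_rules J3 (br_anti Y (D _ _)).
rewrite (br_anti X (D _ _)) (br_anti Z (D _ _)) !DNl; abel.
Qed.

End Bianchi.

(** * The Barthel connection of a semispray *)

Lemma half_double (R : numFieldType) (V : lmodType R) (y : V) :
  2^-1 *: (y + y) = y.
Proof.
rewrite scalerDr -scalerDl -[RHS]scale1r; congr (_ *: _); by field.
Qed.

(** [V] stands for the vector fields, [barthel] for [Gamma = [J,S]], and [lift]
expresses that [S] is a semispray: [S] lifts each vertical [X] to [[X,S]],
a field that [J] maps back to [X]. *)
Section Spray.
Variables (R : numFieldType) (V : lmodType R) (br : V -> V -> V) (J : V -> V).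
Variable S : V.

Definition barthel X := - (br S (J X) - J (br S X)).
Definition hor X := 2^-1 *: (X + barthel X).
Definition ver X := 2^-1 *: (X - barthel X).

Hypotheses (brDl : forall X Y Z, br (X + Y) Z = br X Z + br Y Z)
  (br_anti : forall X Y, br X Y = - br Y X)
  (jacobi : forall X Y Z, br X (br Y Z) + br Y (br Z X) + br Z (br X Y) = 0)
  (JD : forall X Y, J (X + Y) = J X + J Y) (JJ : forall X, J (J X) = 0)
  (nijenhuis : forall X Y, br (J X) (J Y) = J (br (J X) Y) + J (br X (J Y)))
  (lift : forall X, J X = 0 -> J (br X S) = X).

Let brDr X Y Z : br X (Y + Z) = br X Y + br X Z.
Proof. by rewrite br_anti brDl opprD -!br_anti. Qed.
Let brNl X Y : br (- X) Y = - br X Y.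
Proof. by rewrite (mapN (f := br^~ Y)). Qed.
Let brNr X Y : br X (- Y) = - br X Y.
Proof. by rewrite (mapN (f := br X)). Qed.
Let JN X : J (- X) = - J X.
Proof. exact: mapN. Qed.
Let J0 : J 0 = 0.
Proof. exact: map0. Qed.

Notation G := barthel.

Lemma barthelD X Y : G (X + Y) = G X + G Y.
Proof. by rewrite /barthel !(JD, brDr); abel. Qed.

Let GN X : G (- X) = - G X.
Proof. exact/mapN/barthelD. Qed.

Lemma J_barthel X : J (G X) = J X.
Proof.
rewrite /barthel opprD opprK JD JJ addr0 -br_anti.
exact: lift (JJ X).
Qed.

Lemma barthel_J X : G (J X) = - J X.
Proof.
rewrite /barthel JJ (map0 (f := br S)) // sub0r opprK br_anti JN.
by rewrite (lift (JJ X)).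
Qed.

(** The kernel of [J] is its image; the rest of the section relies on this to
describe vertical vectors. *)
Lemma vertical_ex X : J X = 0 -> exists Y, X = J Y.
Proof. by move=> /lift <-; exists (br X S). Qed.

(** [Gamma X - X] is vertical and [Gamma] is [-1] on vertical vectors. *)
Lemma barthel_barthel X : G (G X) = X.
Proof.
have [Y E] : exists Y, G X - X = J Y.
  by apply: vertical_ex; rewrite JD JN J_barthel subrr.
have := barthel_J Y; rewrite -E barthelD GN opprB => /(canRL (subrK _)) ->.
by rewrite subrK.
Qed.

Lemma horD X Y : hor (X + Y) = hor X + hor Y.
Proof. by rewrite /hor barthelD -scalerDr; congr (_ *: _); abel. Qed.

Lemma verD X Y : ver (X + Y) = ver X + ver Y.
Proof. by rewrite /ver barthelD -scalerDr; congr (_ *: _); abel. Qed.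

Lemma hor_ver X : hor X + ver X = X.
Proof.
have E : X + G X + (X - G X) = X + X by abel.
by rewrite /hor /ver -scalerDr E half_double.
Qed.

Lemma hor_barthel X : barthel (hor X) = hor X.
Proof.
rewrite /hor map_half; last exact: barthelD.
by rewrite barthelD barthel_barthel addrC.
Qed.

Lemma hor_hor X : hor (hor X) = hor X.
Proof. by rewrite {1}/hor hor_barthel half_double. Qed.

Lemma verE X : ver X = X - hor X.
Proof. by rewrite -{2}(hor_ver X); abel. Qed.

Lemma hor_J X : hor (J X) = 0.
Proof. by rewrite /hor barthel_J subrr scaler0. Qed.

Lemma J_hor X : J (hor X) = J X.
Proof. by rewrite /hor map_half // JD J_barthel half_double. Qed.

Lemma J_ver X : J (ver X) = 0.
Proof. by rewrite verE JD JN J_hor subrr. Qed.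

Lemma ver_hor X : ver (hor X) = 0.
Proof. by rewrite verE hor_hor subrr. Qed.

Lemma ver_ex X : exists Y, ver X = J Y.
Proof. exact/vertical_ex/J_ver. Qed.

(** The vertical distribution is involutive, by the vanishing of the Nijenhuis
tensor. *)
Lemma hor_bracket_vertical X Y : hor (br (J X) (J Y)) = 0.
Proof. by rewrite nijenhuis -JD hor_J. Qed.

(** The left-hand side is [- (1/2) [h,h](X,Y)]; decompose [X] and [Y] in
horizontal and vertical parts and use that vertical fields have vertical
brackets. *)
Lemma barthel_curvatureE X Y :
  - (2^-1 *: (br (hor X) (hor Y) + br (hor X) (hor Y)
    + hor (hor (br X Y)) + hor (hor (br X Y))
    - hor (br (hor X) Y) - hor (br X (hor Y))
    - hor (br (hor X) Y) - hor (br X (hor Y)))) = - ver (br (hor X) (hor Y)).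
Proof.
congr (- _); rewrite hor_hor verE.
have [A EA] := ver_ex X; have [B EB] := ver_ex Y.
have E : hor (br X Y) = hor (br (hor X) Y) + hor (br X (hor Y)) - hor (br (hor X) (hor Y)).
  rewrite -{1 3}(hor_ver X) -{1 2}(hor_ver Y) !(brDl, brDr) !horD.
  by rewrite EA EB hor_bracket_vertical; abel.
rewrite E -[RHS]half_double; congr (_ *: _); abel.
Qed.

(** [[J,Gamma] = 0], obtained by taking the Lie derivative along [S] of
[[J,J] = 0]. *)
Lemma barthel_J_bracket X Y :
  br (J X) (G Y) + br (G X) (J Y) =
  J (br (G X) Y) + J (br X (G Y)) + (G (br (J X) Y) + G (br X (J Y))).
Proof.
have LD A B : br S (br A B) = br (br S A) B + br A (br S B).
  have := jacobi S A B => /eqP; rewrite -addrA addr_eq0 => /eqP ->.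
  by rewrite (br_anti (br S A)) (br_anti S B) brNr; abel.
have N1 := nijenhuis (br S X) Y; have N2 := nijenhuis X (br S Y).
have := congr1 (br S) (nijenhuis X Y); rewrite LD brDr => N3.
have -> : br (J X) (G Y) + br (G X) (J Y) =
    br (J X) (J (br S Y)) + br (J (br S X)) (J Y)
    - (br (br S (J X)) (J Y) + br (J X) (br S (J Y))).
  by rewrite /barthel !(brDl, brDr, brNl, brNr); abel.
rewrite N1 N2 N3 /barthel !LD !(brDl, brDr, brNl, brNr) !(JD, JN) ; abel.
Qed.

(** The torsion of the Barthel connection vanishes: evaluate [[J,Gamma] = 0] on
horizontal fields. *)
Lemma hor_torsion X Y :
  ver (br (J X) (hor Y)) + ver (br (hor X) (J Y)) = J (br (hor X) (hor Y)).
Proof.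
have E Z : G Z = Z - (ver Z + ver Z).
  by rewrite /ver -scalerDr half_double; abel.
have := barthel_J_bracket (hor X) (hor Y).
rewrite !hor_barthel !J_hor !E => H.
set a := br (J X) _ in H *; set b := br _ (J Y) in H *.
rewrite -[RHS]half_double.
have -> : J (br (hor X) (hor Y)) + J (br (hor X) (hor Y)) =
    (ver a + ver b) + (ver a + ver b).
  apply: (addIr (a - (ver a + ver a) + (b - (ver b + ver b)))).
  by rewrite -H; abel.
by rewrite half_double.
Qed.

(** * The Chern connection and its curvatures *)

Section NormalLift.
Variables (F : V -> V) (D C' : V -> V -> V).

Hypotheses (FD : forall X Y, F (X + Y) = F X + F Y)
  (FJ : forall X, F (J X) = hor X) (Fh : forall X, F (hor X) = - J X).

Lemma J_F X : J X = 0 -> J (F X) = X.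
Proof. by move=> /vertical_ex[Y ->]; rewrite FJ J_hor. Qed.

Hypotheses (DDl : forall X Y Z, D (X + Y) Z = D X Z + D Y Z)
  (DDr : forall X Y Z, D X (Y + Z) = D X Y + D X Z)
  (D_J : forall X Y, D X (J Y) = J (D X Y))
  (D_G : forall X Y, D X (G Y) = G (D X Y))
  (D_vertical : forall X Y, D (J X) (J Y) = J (br (J X) Y))
  (D_torsion : forall X Y, J (tors br D (hor X) (hor Y)) = 0).

Let DNl X Y : D (- X) Y = - D X Y.
Proof. by rewrite (mapN (f := D^~ Y)). Qed.
Let DNr X Y : D X (- Y) = - D X Y.
Proof. by rewrite (mapN (f := D X)). Qed.
Let D0r X : D X 0 = 0.
Proof. by rewrite (map0 (f := D X)). Qed.

Lemma D_hor X Y : D X (hor Y) = hor (D X Y).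
Proof. by rewrite /hor map_half // DDr D_G. Qed.

(** [F] is determined by [J] and [h], with which [D] commutes. *)
Lemma D_F X Y : D X (F Y) = F (D X Y).
Proof.
have [W E] := ver_ex Y; rewrite -(hor_ver Y) E !(FD, DDr) Fh FJ DNr D_hor.
by rewrite !D_J D_hor Fh FJ.
Qed.

Hypotheses (C'Dl : forall X Y Z, C' (X + Y) Z = C' X Z + C' Y Z)
  (C'_symm : forall X Y, C' X Y = C' Y X)
  (J_C' : forall X Y, J (C' X Y) = 0).

Let C'Dr X Y Z : C' X (Y + Z) = C' X Y + C' X Z.
Proof. by rewrite C'_symm C'Dl !(C'_symm X). Qed.

(** [Phi] stands for the smooth functions, [Om] for the fundamental form, [dS] for
the derivative along [S] and [L X Y Z] for [hX . g(JY,JZ)].  [Om_J] is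
[i_J Om = 0], [Om_S] is [L_S Om = 0]. *)
Section Metric.
Variables (Phi : lmodType R) (Om : V -> V -> Phi) (dS : Phi -> Phi).
Variable L : V -> V -> V -> Phi.

Hypotheses (OmDl : forall X Y Z, Om (X + Y) Z = Om X Z + Om Y Z)
  (Om_anti : forall X Y, Om X Y = - Om Y X)
  (Om_J : forall X Y, Om (J X) Y = - Om X (J Y))
  (Om_nd : forall X, (forall Y, Om X Y = 0) -> X = 0)
  (Om_S : forall X Y, dS (Om X Y) = Om (br S X) Y + Om X (br S Y)).

Let OmDr X Y Z : Om X (Y + Z) = Om X Y + Om X Z.
Proof. by rewrite Om_anti OmDl opprD -!Om_anti. Qed.
Let OmNl X Y : Om (- X) Y = - Om X Y.
Proof. by rewrite (mapN (f := Om^~ Y)). Qed.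
Let OmNr X Y : Om X (- Y) = - Om X Y.
Proof. by rewrite (mapN (f := Om X)). Qed.

Lemma Om_JJ X Y : Om (J X) (J Y) = 0.
Proof. by rewrite Om_J JJ (map0 (f := Om X)) ?oppr0. Qed.

(** Take the Lie derivative along [S] of [Om(JX,Y) = Om(JY,X)], using
[Gamma = - L_S J]. *)
Lemma Om_barthel X Y : Om (G X) Y = Om (G Y) X.
Proof.
have := congr1 dS (etrans (Om_J X Y) (esym (Om_anti (J Y) X))).
rewrite !Om_S (Om_J X) (Om_J Y) -!Om_anti => E.
rewrite /barthel !(OmNl, OmDl) -[Om (br S (J X)) Y](addrK (Om (J (br S Y)) X)).
by rewrite E; abel.
Qed.

(** On horizontal vectors [Gamma] is the identity, and [Om] is both symmetric by
[Om_barthel] and antisymmetric. *)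
Lemma Om_hor X Y : Om (hor X) (hor Y) = 0.
Proof.
have E : Om (hor X) (hor Y) = - Om (hor X) (hor Y).
  by rewrite -{1}hor_barthel Om_barthel hor_barthel Om_anti.
by rewrite -[LHS]half_double {1}E addNr scaler0.
Qed.

Lemma Om_J_hor X Y : Om (J X) (hor Y) = Om (J X) Y.
Proof.
have [W E] := ver_ex Y.
by rewrite -{2}(hor_ver Y) OmDr E Om_JJ addr0.
Qed.

Hypotheses (metricL : forall X Y Z, L X Y Z =
     Om (D (hor X) (J Y)) (F (J Z)) + Om (J Y) (F (D (hor X) (J Z))))
  (C'_Om : forall X Y Z, Om (C' X Y) Z = 2^-1 *: (L X Y Z
     - Om (br (hor X) (J Y)) (F (J Z)) - Om (J Y) (F (br (hor X) (J Z))))).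

(* The vertical tensor that measures how far D is from the horizontal part of
   the Berwald connection; it turns out to be C'. *)
Let B X Y := D (hor X) (J Y) - ver (br (hor X) (J Y)).

(* The horizontal torsions of D and of the Barthel connection vanish. *)
Let B_sym X Y : B X Y = B Y X.
Proof.
apply/eqP; rewrite -subr_eq0; apply/eqP; rewrite /B.
have := D_torsion X Y; rewrite /tors !(JD, JN) -!D_J !J_hor -hor_torsion => E.
by apply: etrans E; rewrite (br_anti (J X)) (mapN verD); abel.
Qed.

Let B_ex X Y : exists W, B X Y = J W.
Proof.
by apply: vertical_ex; rewrite /B JD JN J_ver -D_J JJ D0r subr0.
Qed.

(* Subtract metricity from the definition of C'; horizontal parts drop out as
   Om vanishes on horizontal and on vertical vectors. *)
Let C'_B X Y Z : Om (C' X Y) Z = 2^-1 *: (Om (B X Y) Z + Om (B X Z) Y).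
Proof.
have [W EW] := B_ex X Y; have [W' EW'] := B_ex X Z.
rewrite C'_Om metricL; congr (_ *: _).
have E1 : D (hor X) (J Y) - br (hor X) (J Y) = B X Y - hor (br (hor X) (J Y)).
  by rewrite /B verE; abel.
have E2 : D (hor X) (J Z) - br (hor X) (J Z) = B X Z - hor (br (hor X) (J Z)).
  by rewrite /B verE; abel.
transitivity (Om (D (hor X) (J Y) - br (hor X) (J Y)) (F (J Z)) +
    Om (J Y) (F (D (hor X) (J Z) - br (hor X) (J Z)))).
  by rewrite OmDl OmNl FD (mapN FD) OmDr OmNr; abel.
rewrite E1 E2 FJ OmDl OmNl Om_hor subr0 EW Om_J_hor -EW; congr (_ + _).
rewrite FD (mapN FD) Fh opprK OmDr Om_JJ addr0 EW' FJ Om_J_hor Om_J.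
by rewrite -Om_anti.
Qed.

(** By [C'_B], twice [Om(C'(X,Y),Z)] is [Om(B(X,Y),Z) + Om(B(X,Z),Y)].  The
symmetry of [C'] then yields [Om(B(X,Z),Y) = Om(B(Y,Z),X)]; with the symmetry of
[B], the trilinear form [Om(B(X,Y),Z)] is totally symmetric and equals
[Om(C'(X,Y),Z)]. *)
Lemma chern_hor_J X Y : D (hor X) (J Y) = ver (br (hor X) (J Y)) + C' X Y.
Proof.
have b3 X1 Y1 Z1 : Om (B X1 Z1) Y1 = Om (B Y1 Z1) X1.
  have := C'_B X1 Y1 Z1; rewrite C'_symm C'_B (B_sym Y1 X1).
  have h0 : 2^-1 != 0 :> R by rewrite invr_eq0 pnatr_eq0.
  by move=> /(scalerI h0)/addrI.
suff E : B X Y = C' X Y by rewrite -E /B; abel.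
apply/eqP; rewrite -subr_eq0; apply/eqP/Om_nd => Z.
by rewrite OmDl OmNl C'_B (B_sym X Z) (b3 Z Y X) (B_sym Y X) half_double subrr.
Qed.

End Metric.

Hypothesis D_hor_J : forall X Y,
  D (hor X) (J Y) = ver (br (hor X) (J Y)) + C' X Y.

Local Notation T := (tors br D).
Local Notation K := (curv br D).

Let JD3 a b c : J (a + b + c) = J a + J b + J c.
Proof. by rewrite !JD. Qed.

Let K0 X Y : K X Y 0 = 0.
Proof. by rewrite /curv !D0r !subr0. Qed.

Let FN X : F (- X) = - F X.
Proof. exact: mapN. Qed.
Let horN X : hor (- X) = - hor X.
Proof. exact/mapN/horD. Qed.

Lemma tors_anti X Y : T X Y = - T Y X.
Proof. by rewrite /tors (br_anti X Y); abel. Qed.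

Lemma torsDl X Y Z : T (X + Y) Z = T X Z + T Y Z.
Proof. by rewrite /tors !(brDl, DDl, DDr); abel. Qed.

Let torsDr X Y Z : T X (Y + Z) = T X Y + T X Z.
Proof. by rewrite tors_anti torsDl opprD -!tors_anti. Qed.

Lemma curv_anti X Y Z : K X Y Z = - K Y X Z.
Proof. by rewrite /curv (br_anti X Y) DNl; abel. Qed.

Lemma curvDl X Y Z W : K (X + Y) Z W = K X Z W + K Y Z W.
Proof. by rewrite /curv !(brDl, DDl, DDr); abel. Qed.

Let curvNl X Z W : K (- X) Z W = - K X Z W.
Proof. by rewrite (mapN (f := fun X => K X Z W)) // => *; rewrite curvDl. Qed.

Lemma curvDr X Y Z W : K X Y (Z + W) = K X Y Z + K X Y W.
Proof. by rewrite /curv !DDr; abel. Qed.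

Lemma curv_J X Y Z : K X Y (J Z) = J (K X Y Z).
Proof. by rewrite /curv !(JD, JN) !D_J. Qed.

Lemma curv_hor X Y Z : K X Y (hor Z) = hor (K X Y Z).
Proof. by rewrite /curv !(horD, horN) !D_hor. Qed.

Lemma curv_F X Y Z : K X Y (F Z) = F (K X Y Z).
Proof. by rewrite /curv !(FD, FN) !D_F. Qed.

(** The Frölicher-Nijenhuis bracket [- (1/2) [h,h]], written out;
[barthel_curvatureE] gives the usual form. *)
Definition barthel_curv X Y :=
  - (2^-1 *: (br (hor X) (hor Y) + br (hor X) (hor Y)
    + hor (hor (br X Y)) + hor (hor (br X Y))
    - hor (br (hor X) Y) - hor (br X (hor Y))
    - hor (br (hor X) Y) - hor (br X (hor Y)))).

Lemma hor_eq0 X : J X = 0 -> hor X = 0.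
Proof. by move=> JX; rewrite -FJ JX (map0 FD). Qed.

Lemma hor_id X : J X = 0 -> hor X = X -> X = 0.
Proof. by move=> /hor_eq0 -> <-. Qed.

(** The torsion is vertical and [D] preserves horizontal fields, so only
[- v[hX,hY]] is left. *)
Lemma tors_hh X Y : T (hor X) (hor Y) = barthel_curv X Y.
Proof.
rewrite /barthel_curv barthel_curvatureE.
have E : ver (T (hor X) (hor Y)) = T (hor X) (hor Y).
  by rewrite verE (hor_eq0 (D_torsion X Y)) subr0.
rewrite -E /tors !(verD, mapN verD) !D_hor !ver_hor; abel.
Qed.

(** [C'] is semibasic: replace [Y] by [JY] in the formula for [D_hX JY]. *)
Lemma C'_J X Y : C' X (J Y) = 0.
Proof.
have := D_hor_J X (J Y); rewrite JJ D0r (map0 (f := br (hor X))) //.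
by rewrite (map0 verD) add0r.
Qed.

Lemma C'_hor X Y : C' X (hor Y) = C' X Y.
Proof.
have [W E] := ver_ex Y.
by rewrite -{2}(hor_ver Y) C'Dr E C'_J addr0.
Qed.

(** Apply [F] to [D_JY JX = J[JY,X]]; in [J[JY,X]] only the horizontal part of
[X] counts. *)
Lemma D_J_hor X Y : D (J Y) (hor X) = hor (br (J Y) (hor X)).
Proof.
have H : J (br (J Y) (ver X)) = 0.
  have [W ->] := ver_ex X; by rewrite nijenhuis JD !JJ addr0.
have E : J (D (J Y) X) = J (br (J Y) (hor X)).
  by rewrite -D_J D_vertical -{1}(hor_ver X) brDr JD H addr0.
by rewrite D_hor -(FJ (D _ _)) E FJ.
Qed.

Lemma tors_hv X Y : T (hor X) (J Y) = C' X Y.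
Proof.
by rewrite /tors D_hor_J D_J_hor (br_anti (J Y)) horN verE; abel.
Qed.

Lemma tors_vv X Y : T (J X) (J Y) = 0.
Proof.
by rewrite /tors !D_vertical nijenhuis (br_anti (J Y)) JN; abel.
Qed.

Lemma tors_vh X Y : T (J X) (hor Y) = - C' X Y.
Proof. by rewrite tors_anti tors_hv C'_symm. Qed.

Lemma tors_vertical X Y : J X = 0 -> J Y = 0 -> T X Y = 0.
Proof. by move=> /vertical_ex[A ->] /vertical_ex[A' ->]; exact: tors_vv. Qed.

Lemma tors_Fh X Y : J X = 0 -> T X (hor Y) = - C' (F X) Y.
Proof.
by move=> /vertical_ex[A ->]; rewrite tors_vh FJ C'_symm -C'_hor C'_symm.
Qed.

Lemma J_barthel_curv X Y : J (barthel_curv X Y) = 0.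
Proof. by rewrite -tors_hh D_torsion. Qed.

(** Each of the components [tors_hh], [tors_hv], [tors_vv] is vertical. *)
Lemma J_tors X Y : J (T X Y) = 0.
Proof.
have [A EA] := ver_ex X; have [A' EA'] := ver_ex Y.
have := J_barthel_curv X Y; rewrite -{2}(hor_ver X) -{2}(hor_ver Y) EA EA'.
rewrite !(torsDl, torsDr) tors_hh tors_hv tors_vh tors_vv.
move: (barthel_curv X Y) => r Jr.
by rewrite !JD JN !J_C' J0 Jr oppr0 !addr0.
Qed.

Lemma J_nabla2_tors X Y Z : J (nabla2 D X T Y Z) = 0.
Proof.
rewrite /nabla2; have := D_J X (T Y Z); have := J_tors (D X Y) Z.
have := J_tors Y (D X Z); rewrite (J_tors Y Z) D0r.
move: (D X (T Y Z)) (T (D X Y) Z) (T Y (D X Z)) => a b c Jc Jb Ja.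
by rewrite !(JD, JN) Jb Jc -Ja oppr0 !addr0.
Qed.

Let bianchi X Y Z := bianchi1 brDl br_anti jacobi DDl DDr X Y Z.
Let bianchi' X Y Z W := bianchi2 brDl br_anti jacobi DDl DDr X Y Z W.

(** The first Bianchi identity modulo vertical vectors: the torsion and its
covariant derivatives are vertical. *)
Lemma J_bianchi X Y Z : J (K X Y Z) + J (K Y Z X) + J (K Z X Y) = 0.
Proof.
have J6 a b c d e f : J (a + b + c + (d + e + f)) = J a + J b + J c + (J d + J e + J f).
  by rewrite !JD.
by rewrite -JD3 bianchi J6 !J_nabla2_tors !J_tors !addr0.
Qed.

Definition hcurv X Y Z := K (hor X) (hor Y) (J Z).
Definition hvcurv X Y Z := K (hor X) (J Y) (J Z).

Lemma hcurv_cyclic X Y Z : hcurv X Y Z + hcurv Y Z X + hcurv Z X Y = 0.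
Proof.
by rewrite /hcurv -!(J_hor Z) -!(J_hor X) -!(J_hor Y) !curv_J; exact: J_bianchi.
Qed.

Lemma nabla2_tors_hor X Y Z :
  nabla2 D (hor X) T (hor Y) (hor Z) = nabla2 D (hor X) barthel_curv Y Z.
Proof. by rewrite /nabla2 !D_hor !tors_hh. Qed.

(** The first Bianchi identity on horizontal fields: the curvature terms form a
horizontal vector annihilated by [J], hence 0, and the torsion terms are the
claim. *)
Lemma barthel_curv_bianchi X Y Z :
  nabla2 D (hor X) barthel_curv Y Z + nabla2 D (hor Y) barthel_curv Z X
    + nabla2 D (hor Z) barthel_curv X Y =
  C' (F (barthel_curv X Y)) Z + C' (F (barthel_curv Y Z)) X
    + C' (F (barthel_curv Z X)) Y.
Proof.
have := bianchi (hor X) (hor Y) (hor Z).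
set s := (X in X = _ -> _) => E.
have s0 : s = 0.
  apply: hor_id; first by rewrite /s JD3; exact: J_bianchi.
  by rewrite /s !curv_hor -!horD hor_hor.
move: E; rewrite s0 !nabla2_tors_hor !tors_hh !(tors_Fh _ (J_barthel_curv _ _)).
by move=> /esym/eqP; rewrite -!opprD subr_eq0 => /eqP.
Qed.

(** [J_bianchi] on [hX], [JY], [hZ]; one of its terms contains [J(JY)]. *)
Lemma hvcurv_sym X Y Z : hvcurv X Y Z = hvcurv Z Y X.
Proof.
have := J_bianchi (hor X) (J Y) (hor Z).
rewrite -!curv_J JJ K0 addr0 !J_hor (curv_anti (J Y)) => /eqP.
by rewrite subr_eq0 => /eqP.
Qed.

(** [J_bianchi] on [hW], [JX], [JY] leaves the curvature on [JW] only; [F] carries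
the result to horizontal vectors. *)
Lemma curv_vertical X Y Z : K (J X) (J Y) Z = 0.
Proof.
have vJ W : K (J X) (J Y) (J W) = 0.
  have := J_bianchi (hor W) (J X) (J Y).
  by rewrite -!curv_J !JJ !K0 J_hor add0r addr0.
have [W E] := ver_ex Z.
by rewrite -(hor_ver Z) curvDr E vJ addr0 -FJ curv_F vJ (map0 FD).
Qed.

Lemma curv_vertical2 X Y Z : J X = 0 -> J Y = 0 -> K X Y Z = 0.
Proof. by move=> /vertical_ex[A ->] /vertical_ex[A' ->]; exact: curv_vertical. Qed.

(** The first Bianchi identity on [hX], [JY], [JZ].  The terms in [T(T,.)] vanish
as the torsion is vertical and vertical vectors have no torsion. *)
Lemma hvcurv_C' X Y Z :
  hvcurv X Y Z - hvcurv X Z Y = nabla2 D (J Z) C' X Y - nabla2 D (J Y) C' X Z.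
Proof.
have := bianchi (hor X) (J Y) (J Z).
rewrite curv_vertical addr0 (curv_anti (J Z)) -/(hvcurv X Z Y) -/(hvcurv X Y Z).
have tt A A' A'' : T (T A (J A')) (J A'') = 0.
  by apply: tors_vertical; [exact: J_tors|exact: JJ].
have t0 A : T 0 A = 0 by rewrite (map0 (f := T^~ A)) // => *; rewrite torsDl.
rewrite tt tors_vv t0 [T (J Z) _]tors_anti (mapN (f := T^~ _)); last first.
  by move=> *; rewrite torsDl.
rewrite tt oppr0 !addr0 => ->.
have -> : nabla2 D (hor X) T (J Y) (J Z) = 0.
  by rewrite /nabla2 tors_vv D0r !D_J !tors_vv !subr0.
have -> : nabla2 D (J Y) T (J Z) (hor X) = - nabla2 D (J Y) C' X Z.
  rewrite /nabla2 D_J D_hor !tors_vh DNr (C'_symm Z X) (C'_symm (D _ Z)).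
  by rewrite (C'_symm Z); abel.
have -> : nabla2 D (J Z) T (hor X) (J Y) = nabla2 D (J Z) C' X Y.
  by rewrite /nabla2 D_J D_hor !tors_hv.
abel.
Qed.

Lemma curv_hF X A W : J A = 0 -> K (hor X) A (J W) = hvcurv X (F A) W.
Proof. by move=> JA; rewrite /hvcurv J_F. Qed.

(** The second Bianchi identity on [hX], [hY], [hZ]; the vertical vector
[T(hX,hY) = Rb(X,Y)] is written [J F Rb(X,Y)]. *)
Lemma hcurv_bianchi X Y Z W :
  nabla3 D (hor X) hcurv Y Z W + nabla3 D (hor Y) hcurv Z X W
    + nabla3 D (hor Z) hcurv X Y W =
  hvcurv X (F (barthel_curv Y Z)) W + hvcurv Y (F (barthel_curv Z X)) W
    + hvcurv Z (F (barthel_curv X Y)) W.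
Proof.
have E A B' A' : nabla3 D (hor A) K (hor B') (hor A') (J W) = nabla3 D (hor A) hcurv B' A' W.
  by rewrite /nabla3 !D_hor !D_J.
have := bianchi' (hor X) (hor Y) (hor Z) (J W); rewrite !E !tors_hh.
rewrite !(curv_anti (barthel_curv _ _)) !curv_hF ?J_barthel_curv // => H.
by apply/subr0_eq; apply: etrans H; abel.
Qed.

(** The second Bianchi identity on [hX], [hY], [JZ]; the term [K(T(hX,hY),JZ)]
vanishes by [curv_vertical]. *)
Lemma hvcurv_bianchi X Y Z W :
  nabla3 D (hor X) hvcurv Y Z W - nabla3 D (hor Y) hvcurv X Z W
    + nabla3 D (J Z) hcurv X Y W =
  hvcurv X (F (C' Y Z)) W - hvcurv Y (F (C' X Z)) W.
Proof.
have := bianchi' (hor X) (hor Y) (J Z) (J W).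
have -> : nabla3 D (hor X) K (hor Y) (J Z) (J W) = nabla3 D (hor X) hvcurv Y Z W.
  by rewrite /nabla3 !D_hor !D_J.
have -> : nabla3 D (hor Y) K (J Z) (hor X) (J W) = - nabla3 D (hor Y) hvcurv X Z W.
  rewrite /nabla3 !D_hor !D_J !(curv_anti (J _)) DNr /hvcurv; abel.
have -> : nabla3 D (J Z) K (hor X) (hor Y) (J W) = nabla3 D (J Z) hcurv X Y W.
  by rewrite /nabla3 !D_hor !D_J.
rewrite tors_hh tors_hv tors_vh curv_vertical2 ?JJ ?J_barthel_curv // add0r.
rewrite curvNl (C'_symm Z) !(curv_anti (C' _ _)) !curv_hF // => H.
by apply/subr0_eq; apply: etrans H; abel.
Qed.

(** The second Bianchi identity on [hX], [JY], [JZ]; all torsion terms give the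
curvature of two vertical vectors. *)
Lemma hvcurv_bianchi_vertical X Y Z W :
  nabla3 D (J Y) hvcurv X Z W = nabla3 D (J Z) hvcurv X Y W.
Proof.
have := bianchi' (hor X) (J Y) (J Z) (J W).
have -> : nabla3 D (hor X) K (J Y) (J Z) (J W) = 0.
  by rewrite /nabla3 !D_J !curv_vertical D0r !subr0.
have -> : nabla3 D (J Y) K (J Z) (hor X) (J W) = - nabla3 D (J Y) hvcurv X Z W.
  rewrite /nabla3 !D_hor !D_J !(curv_anti (J _)) DNr /hvcurv; abel.
have -> : nabla3 D (J Z) K (hor X) (J Y) (J W) = nabla3 D (J Z) hvcurv X Y W.
  by rewrite /nabla3 !D_hor !D_J.
rewrite tors_hv tors_vv tors_vh curvNl.
rewrite !(curv_vertical2 _ (J_C' _ _) (JJ _)) (map0 (f := fun A => K A _ _)); last first.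
  by move=> A A'; rewrite curvDl.
by rewrite oppr0 !addr0 add0r addrC => /subr0_eq.
Qed.

Theorem chern_bianchi X Y Z :
  hcurv X Y Z + hcurv Y Z X + hcurv Z X Y = 0 /\
  nabla2 D (hor X) barthel_curv Y Z + nabla2 D (hor Y) barthel_curv Z X
    + nabla2 D (hor Z) barthel_curv X Y =
  C' (F (barthel_curv X Y)) Z + C' (F (barthel_curv Y Z)) X
    + C' (F (barthel_curv Z X)) Y /\
  hvcurv X Y Z = hvcurv Z Y X /\
  hvcurv X Y Z - hvcurv X Z Y = nabla2 D (J Z) C' X Y - nabla2 D (J Y) C' X Z /\
  (forall W, nabla3 D (hor X) hcurv Y Z W + nabla3 D (hor Y) hcurv Z X W
      + nabla3 D (hor Z) hcurv X Y W =
    hvcurv X (F (barthel_curv Y Z)) W + hvcurv Y (F (barthel_curv Z X)) W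
      + hvcurv Z (F (barthel_curv X Y)) W) /\
  (forall W, nabla3 D (hor X) hvcurv Y Z W - nabla3 D (hor Y) hvcurv X Z W
      + nabla3 D (J Z) hcurv X Y W =
    hvcurv X (F (C' Y Z)) W - hvcurv Y (F (C' X Z)) W) /\
  (forall W, nabla3 D (J Y) hvcurv X Z W = nabla3 D (J Z) hvcurv X Y W).
Proof.
split; first exact: hcurv_cyclic.
split; first exact: barthel_curv_bianchi.
split; first exact: hvcurv_sym.
split; first exact: hvcurv_C'.
split; first by move=> W; exact: hcurv_bianchi.
split=> W; first exact: hvcurv_bianchi.
exact: hvcurv_bianchi_vertical.
Qed.

End NormalLift.
End Spray.

(** * The module of smooth vector fields *)

Section VectorFields.
Variables (R : realType) (n : nat) (M : manifold R n).
Local Notation SA := (slit_charts M).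
Local Notation field := (rawfield SA).

Let HS : is_atlas SA := slit_is_atlas M.

Definition vfields : {pred field} := fun X => `[<is_vfield X>].

Lemma vfields_submod : submod_closed vfields.
Proof.
split; first exact/asboolP/(vfield0 HS).
move=> a X Y /asboolP hX /asboolP hY; apply/asboolP.
by apply: (vfieldD HS) => //; exact: (vfieldZ HS).
Qed.

HB.instance Definition _ := GRing.isSubmodClosed.Build R field vfields
  vfields_submod.

(** Tensors and connections are additive on smooth fields only.  Bundling the
smooth fields into a module makes the additivity unconditional. *)
Record vfield := VField { vf_val :> field; _ : vf_val \in vfields }.

HB.instance Definition _ := [isSub for vf_val].
HB.instance Definition _ := [Choice of vfield by <:].
HB.instance Definition _ := [SubChoice_isSubLmodule of vfield by <:].

Lemma vfieldP (X : vfield) : is_vfield X.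
Proof. by case: X => X /= /asboolP. Qed.

Definition mkV (X : field) (hX : is_vfield X) : vfield := VField (asboolT hX).

Lemma vf_valD (X Y : vfield) : vf_val (X + Y) = vf_val X + vf_val Y.
Proof. by []. Qed.

Lemma vf_valN (X : vfield) : vf_val (- X) = - vf_val X.
Proof. by []. Qed.

Lemma vf_valZ c (X : vfield) : vf_val (c *: X) = c *: vf_val X.
Proof. by []. Qed.

Definition brV (X Y : vfield) : vfield :=
  mkV (vfield_bracket HS (vfieldP X) (vfieldP Y)).

Definition JV (X : vfield) : vfield := mkV (vfield_J (vfieldP X)).

Lemma vf_inj (X Y : vfield) : vf_val X = vf_val Y -> X = Y.
Proof. exact: val_inj. Qed.

Lemma brV_Dl X Y Z : brV (X + Y) Z = brV X Z + brV Y Z.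
Proof. by apply: vf_inj; exact: (bracketDl HS (vfieldP X) (vfieldP Y) (vfieldP Z)). Qed.

Lemma brV_anti X Y : brV X Y = - brV Y X.
Proof. by apply: vf_inj; exact: bracket_anti. Qed.

Lemma brV_jacobi X Y Z :
  brV X (brV Y Z) + brV Y (brV Z X) + brV Z (brV X Y) = 0.
Proof.
by apply: vf_inj; exact: (bracket_jacobi HS (vfieldP X) (vfieldP Y) (vfieldP Z)).
Qed.

Lemma JV_D X Y : JV (X + Y) = JV X + JV Y.
Proof. by apply: vf_inj; exact: (JD X Y). Qed.

Lemma JV_JV X : JV (JV X) = 0.
Proof. by apply: vf_inj; exact: (JJ X). Qed.

Lemma JV_nijenhuis X Y : brV (JV X) (JV Y) = JV (brV (JV X) Y) + JV (brV X (JV Y)).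
Proof. by apply: vf_inj; exact: (J_nijenhuis (vfieldP X) (vfieldP Y)). Qed.

Definition CV : vfield := mkV (vfield_Liouville M).

Lemma CV_JV X : brV CV (JV X) = JV (brV CV X) - JV X.
Proof. by apply: vf_inj; exact: (Liouville_J (vfieldP X)). Qed.

Lemma JV_CV : JV CV = 0.
Proof.
apply: vf_inj; apply/funext => u; apply/funext => i.
by rewrite -[LHS]/(row_mx 0 (lsubmx (row_mx 0 _))) row_mxKl row_mx0.
Qed.

Lemma JV_lift X S : JV X = 0 -> JV S = CV -> JV (brV X S) = X.
Proof.
move=> JX JS; apply: vf_inj; apply: (semispray_lift (vfieldP X) (vfieldP S)).
  exact: (congr1 vf_val JX).
exact: (congr1 vf_val JS).
Qed.

Definition lie (X : vfield) (f : slit_bundle M -> R) : slit_bundle M -> R :=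
  lie_fun X f.

Lemma lieE X f : lie X f = lie_fun X f.
Proof. by []. Qed.

Local Notation sm := (smooth_fun SA).

Lemma lie_smooth X f : sm f -> sm (lie X f).
Proof. exact: (lie_fun_smooth HS (vfieldP X)). Qed.

Lemma lieDl X Y f : sm f -> lie (X + Y) f = lie X f + lie Y f.
Proof. exact: (lie_funDl HS). Qed.

Lemma lieDr X f g : sm f -> sm g -> lie X (f + g) = lie X f + lie X g.
Proof. exact: (lie_funDr HS). Qed.

Lemma lie0l f : lie 0 f = 0.
Proof. by apply/funext => p; rewrite /lie /lie_fun derive0. Qed.

Lemma lie0r X : lie X 0 = 0.
Proof.
apply/funext => p; rewrite /lie /lie_fun.
have -> : rep (chart_at SA p) (0 : slit_bundle M -> R) = fun=> 0.
  by apply/funext => z; rewrite /rep; case: pselect.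
exact: derive_cst.
Qed.

Lemma lieNl X f : sm f -> lie (- X) f = - lie X f.
Proof.
by move=> hf; apply/eqP; rewrite -addr_eq0 -lieDl // addNr lie0l.
Qed.

Lemma smoothN f : sm f -> sm (- f).
Proof.
move=> hf k i.
have C := Ck_scale (open_img HS i) (Ck_cst (open_img HS i) k (-1 : R)) (hf k i).
apply: (Ck_ext (open_img HS i) _ C) => _ [p ip <-].
by rewrite !(rep_cmap HS) // scaleN1r.
Qed.

Lemma smoothD f g : sm f -> sm g -> sm (f + g).
Proof.
move=> hf hg k i; have C := CkD (open_img HS i) (hf k i) (hg k i).
by apply: (Ck_ext (open_img HS i) _ C) => _ [p ip <-]; rewrite !(rep_cmap HS).
Qed.

Lemma lieNr X f : sm f -> lie X (- f) = - lie X f.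
Proof.
move=> hf; apply/eqP; rewrite -addr_eq0 -lieDr //; last exact: smoothN.
by rewrite addNr lie0r.
Qed.

Lemma smoothB f g : sm f -> sm g -> sm (f - g).
Proof. by move=> hf hg; exact: smoothD (smoothN hg). Qed.

Lemma lieBr X f g : sm f -> sm g -> lie X (f - g) = lie X f - lie X g.
Proof. by move=> hf hg; rewrite lieDr ?lieNr //; exact: smoothN. Qed.

Lemma lieB X Y f : sm f -> lie (brV X Y) f = lie X (lie Y f) - lie Y (lie X f).
Proof. exact: (lie_fun_bracket HS (vfieldP X) (vfieldP Y)). Qed.

End VectorFields.

(** * The fundamental form and the canonical spray *)

Section CartanForm.
Variables (R : realType) (n : nat) (M : manifold R n) (E : tangent_bundle M -> R).
Hypothesis hE : is_finsler E.

Local Notation vf := (vfield M).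
Local Notation f := (slit_fun E).
Implicit Types X Y Z S : vf.

Let sf : smooth_fun (slit_charts M) f := fin_smooth hE.

Definition OmV (X Y : vf) : slit_bundle M -> R := Omega E X Y.

Lemma OmVE X Y :
  OmV X Y = lie X (lie (JV Y) f) - lie Y (lie (JV X) f) - lie (JV (brV X Y)) f.
Proof. by []. Qed.

Lemma OmV_nd X : (forall Y, OmV X Y = 0) -> X = 0.
Proof.
move=> X0; apply: vf_inj; apply/funext => u.
apply: (fin_rank hE (vfieldP X)) => Y hY.
exact: (congr1 (@^~ u) (X0 (mkV hY))).
Qed.

Local Opaque lie brV JV OmV.

Let s1 X : smooth_fun (slit_charts M) (lie X f).
Proof. exact: lie_smooth. Qed.
Let s2 X Y : smooth_fun (slit_charts M) (lie X (lie Y f)).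
Proof. by do 2!apply: lie_smooth. Qed.

Lemma OmV_Dl X Y Z : OmV (X + Y) Z = OmV X Z + OmV Y Z.
Proof.
by rewrite !OmVE brV_Dl !JV_D !lieDl // lieDr //; abel.
Qed.

Lemma OmV_anti X Y : OmV X Y = - OmV Y X.
Proof.
by rewrite !OmVE brV_anti (mapN (@JV_D _ _ _)) lieNl //; abel.
Qed.

(** [Omega = dd_J E] and [J] is integrable with [J \o J = 0]. *)
Lemma OmV_J X Y : OmV (JV X) Y = - OmV X (JV Y).
Proof.
rewrite !OmVE !JV_JV !lie0l !lie0r.
have := congr1 (fun A => lie A f) (JV_nijenhuis X Y); rewrite lieB // lieDl // => H.
by apply/eqP; rewrite -addr_eq0; apply/eqP; rewrite -[RHS](subrr (lie (JV (brV (JV X) Y)) f + lie (JV (brV X (JV Y))) f)) -{1}H; abel.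
Qed.

Lemma lie_CV : lie (CV M) f = f + f.
Proof.
apply/funext => u; rewrite lieE; apply: etrans (fin_homogeneous hE u) _.
by rewrite -[RHS]/(f u + f u); ring.
Qed.

(** [i_C Omega = d_J E], from [[C,J] = - J] and the homogeneity of the energy. *)
Lemma OmV_CV X : OmV (CV M) X = lie (JV X) f.
Proof.
have := congr1 (fun A => lie A f) (CV_JV X).
rewrite (lieB _ _ sf) lie_CV (lieDr _ sf sf) (lieDl _ _ sf) (lieNl _ sf) => H.
rewrite OmVE JV_CV lie0l lie0r.
by move/eqP: H; rewrite subr_eq => /eqP ->; abel.
Qed.

Section CanonicalSpray.
Variable S : vf.
Hypothesis OmS : forall X, OmV S X = - lie X f.

(** [Omega(JS,X) = - Omega(S,JX) = JX . E = Omega(C,X)]; conclude by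
nondegeneracy. *)
Lemma spray_semispray : JV S = CV M.
Proof.
apply/eqP; rewrite -subr_eq0; apply/eqP/OmV_nd => X.
rewrite OmV_Dl (mapN (f := OmV^~ X)) //; last by move=> *; rewrite OmV_Dl.
by rewrite OmV_J OmS OmV_CV opprK subrr.
Qed.

(** [L_S Omega = d i_S Omega = - ddE = 0].  In the computation, [i_S Omega = - dE]
gives the derivative along [S] of the form [d_J E] ([SJ]), and the exterior
derivative of this identity is taken by hand. *)
Lemma lie_spray_OmV X Y : lie S (OmV X Y) = OmV (brV S X) Y + OmV X (brV S Y).
Proof.
pose q := lie (JV S) f; have sq : smooth_fun (slit_charts M) q by exact: s1.
have SJ Z : lie S (lie (JV Z) f) = lie Z q + lie (JV (brV S Z)) f - lie Z f.
  by have := OmS Z; rewrite OmVE -/q => <-; abel.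
have LX A Z : lie A (lie S (lie (JV Z) f)) =
    lie A (lie Z q) + lie A (lie (JV (brV S Z)) f) - lie A (lie Z f).
  have sq' : smooth_fun (slit_charts M) (lie Z q) by exact: lie_smooth.
  by rewrite SJ (lieBr A (smoothD sq' (s1 _)) (s1 _)) (lieDr A sq' (s1 _)).
have jac : lie (JV (brV S (brV X Y))) f =
    lie (JV (brV (brV S X) Y)) f + lie (JV (brV X (brV S Y))) f.
  have := brV_jacobi S X Y => /eqP; rewrite -addrA addr_eq0 => /eqP ->.
  rewrite -(lieDl _ _ sf) -JV_D; apply: (congr1 (fun A => lie (JV A) f)).
  rewrite (brV_anti (brV S X)) (brV_anti S Y).
  by rewrite (mapN (f := brV X)) => [|A B]; [abel|rewrite !(brV_anti X) brV_Dl; abel].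
have E1 : lie S (OmV X Y) = lie S (lie X (lie (JV Y) f))
    - lie S (lie Y (lie (JV X) f)) - lie S (lie (JV (brV X Y)) f).
  by rewrite OmVE (lieBr S (smoothB (s2 _ _) (s2 _ _)) (s1 _)) (lieBr S (s2 _ _) (s2 _ _)).
rewrite E1 !OmVE (lieB S X (s1 _)) (lieB S Y (s1 _)) SJ jac (lieB X Y sq) (lieB X Y sf).
have alg (U : zmodType) (a1 a2 a3 b1 b2 b3 c1 c2 j1 j2 l1 l2 : U) :
    l1 = a1 + a2 - a3 -> l2 = b1 + b2 - b3 ->
    c1 - c2 - (a1 - b1 + (j1 + j2) - (a3 - b3)) =
    c1 - l1 - b2 - j1 + (a2 - (c2 - l2) - j2) by move=> -> ->; abel.
exact: (alg _ _ _ _ _ _ _ _ _ _ _ _ _ (LX X Y) (LX Y X)).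
Qed.

End CanonicalSpray.

End CartanForm.

(** * The Bianchi identities of the Chern connection *)

Theorem proposition4p7 (R : realType) (n : nat) (M : manifold R n)
  (E : tangent_bundle M -> R)
  (S : rawfield (slit_charts M))
  (F : rawfield (slit_charts M) -> rawfield (slit_charts M))
  (C' : rawfield (slit_charts M) -> rawfield (slit_charts M) ->
        rawfield (slit_charts M))
  (D : rawfield (slit_charts M) -> rawfield (slit_charts M) ->
       rawfield (slit_charts M))
  (hE : is_finsler E)
  (hS : is_canonical_spray E S)
  (hF : is_almost_complex S F)
  (hC' : is_second_Cartan E S F C')
  (hD : is_Chern E S F D)
  (X Y Z : rawfield (slit_charts M))
  (hX : is_vfield X) (hY : is_vfield Y) (hZ : is_vfield Z) :
  let h := hproj S in
  let Rb := Barthel_curvature S in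
  let Rh := h_curv S D in
  let P := hv_curv S D in
  (* (a) *)
  cyclic_sum (fun X Y Z => Rh X Y Z) X Y Z = 0 /\
  (* (b) *)
  cyclic_sum (fun X Y Z => cov2 D (h X) Rb Y Z) X Y Z =
    cyclic_sum (fun X Y Z => C' (F (Rb X Y)) Z) X Y Z /\
  (* (c) *)
  P X Y Z = P Z Y X /\
  (* (d) *)
  P X Y Z - P X Z Y = cov2 D (J Z) C' X Y - cov2 D (J Y) C' X Z /\
  (* (e) *)
  (forall W, is_vfield W ->
     cyclic_sum (fun X Y Z => cov3 D (h X) Rh Y Z W) X Y Z =
     cyclic_sum (fun X Y Z => P X (F (Rb Y Z)) W) X Y Z) /\
  (* (f) *)
  (forall W, is_vfield W ->
     cov3 D (h X) P Y Z W - cov3 D (h Y) P X Z W + cov3 D (J Z) Rh X Y W =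
     P X (F (C' Y Z)) W - P Y (F (C' X Z)) W) /\
  (* (g) *)
  (forall W, is_vfield W ->
     cov3 D (J Y) P X Z W = cov3 D (J Z) P X Y W).
Proof.
move=> h Rb Rh P.
pose SV : vfield M := mkV hS.1.
have cD := Chern_connection hD; have [[fF FDr _] FJr Fhr] := hF.
have C'L B : is_vfield B -> is_vector_1form (fun A => C' A B).
  exact: (v2t_left (C'_tensor hC')).
pose FV (A : vfield M) : vfield M := mkV (fF A (vfieldP A)).
pose DV (A B : vfield M) : vfield M := mkV (conn_field cD (vfieldP A) (vfieldP B)).
pose CV' (A B : vfield M) : vfield M :=
  mkV (v1f_field (C'L B (vfieldP B)) (vfieldP A)).
pose hV := hor (@brV R n M) (@JV R n M) SV.
have OmS A : OmV E SV A = - lie A (slit_fun E).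
  by apply/funext => u; exact: (hS.2 A (vfieldP A) u).
have JS := spray_semispray hE OmS.
have lift A : JV A = 0 -> JV (brV A SV) = A by move=> JA; exact: (JV_lift JA JS).
have FD A B : FV (A + B) = FV A + FV B.
  by apply: vf_inj; exact: (FDr A B (vfieldP A) (vfieldP B)).
have FJ A : FV (JV A) = hV A by apply: vf_inj; exact: (FJr A (vfieldP A)).
have Fh A : FV (hV A) = - JV A by apply: vf_inj; exact: (Fhr A (vfieldP A)).
have DDl A B B' : DV (A + B) B' = DV A B' + DV B B'.
  by apply: vf_inj; exact: (conn_addl cD (vfieldP A) (vfieldP B) (vfieldP B')).
have DDr A B B' : DV A (B + B') = DV A B + DV A B'.
  by apply: vf_inj; exact: (conn_addr cD (vfieldP A) (vfieldP B) (vfieldP B')).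
have D_J A B : DV A (JV B) = JV (DV A B).
  by apply: vf_inj; exact: (Chern_J hD (vfieldP A) (vfieldP B)).
pose GV := barthel (@brV R n M) (@JV R n M) SV.
have D_G A B : DV A (GV B) = GV (DV A B).
  by apply: vf_inj; exact: (Chern_Barthel hD (vfieldP A) (vfieldP B)).
have D_v A B : DV (JV A) (JV B) = JV (brV (JV A) B).
  by apply: vf_inj; exact: (Chern_vertical hD (vfieldP A) (vfieldP B)).
have D_t A B : JV (tors (@brV R n M) DV (hV A) (hV B)) = 0.
  by apply: vf_inj; exact: (Chern_torsion hD (vfieldP A) (vfieldP B)).
have C'D A B B' : CV' (A + B) B' = CV' A B' + CV' B B'.
  by apply: vf_inj; exact: (v1f_add (C'L _ (vfieldP B')) (vfieldP A) (vfieldP B)).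
have C'_s A B : CV' A B = CV' B A.
  by apply: vf_inj; exact: (C'_sym hC' (vfieldP A) (vfieldP B)).
have J_C' A B : JV (CV' A B) = 0.
  by apply: vf_inj; exact: (C'_vertical hC' (vfieldP A) (vfieldP B)).
pose L (A B B' : vfield M) : slit_bundle M -> R :=
  lie_fun (hproj S A) (metric E F (J B) (J B')).
have metricL A B B' : L A B B' =
    OmV E (DV (hV A) (JV B)) (FV (JV B')) + OmV E (JV B) (FV (DV (hV A) (JV B'))).
  apply/funext => u.
  have := Chern_metric hD (vfieldP A) (vfieldP (JV B)) (vfieldP (JV B')) u.
  by move=> /eqP; rewrite /cov_form2 -addrA -opprD subr_eq0 => /eqP.
have C'_Om A B B' : OmV E (CV' A B) B' = (2^-1 : R) *: (L A B B'
    - OmV E (brV (hV A) (JV B)) (FV (JV B'))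
    - OmV E (JV B) (FV (brV (hV A) (JV B')))).
  by apply/funext => u; exact: (C'_def hC' (vfieldP A) (vfieldP B) (vfieldP B') u).
have hJ := chern_hor_J (@brV_Dl R n M) (@brV_anti R n M) (@brV_jacobi R n M)
  (@JV_D R n M) (@JV_JV R n M) (@JV_nijenhuis R n M) lift FD FJ Fh DDr D_J
  D_t C'_s (OmV_Dl hE) (OmV_anti hE) (OmV_J hE) (OmV_nd hE) (lie_spray_OmV hE OmS)
  metricL C'_Om.
pose x := mkV hX; pose y := mkV hY; pose z := mkV hZ.
have val3 (A B B' : vfield M) : vf_val (A + B + B') = vf_val A + vf_val B + vf_val B' by [].
have valB (A B : vfield M) : vf_val (A - B) = vf_val A - vf_val B by [].
have valBD (A B B' : vfield M) : vf_val (A - B + B') = vf_val A - vf_val B + vf_val B' by [].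
(* A covariant derivative of a tensor involves its values on smooth fields
   only, so it can be computed in the module of smooth fields. *)
have nab2 (Q : vfield M -> vfield M -> vfield M) Q' :
    (forall A B, vf_val (Q A B) = Q' (vf_val A) (vf_val B)) ->
    forall A B B', vf_val (nabla2 DV A Q B B') = cov2 D A Q' B B'.
  by move=> QE A B B'; rewrite /cov2 -(QE B B') -(QE (DV A B) B') -(QE B (DV A B')).
have nab3 (Q : vfield M -> vfield M -> vfield M -> vfield M) Q' :
    (forall A B B', vf_val (Q A B B') = Q' (vf_val A) (vf_val B) (vf_val B')) ->
    forall A B B' W, vf_val (nabla3 DV A Q B B' W) = cov3 D A Q' B B' W.
  move=> QE A B B' W; rewrite /cov3 -(QE B B' W) -(QE (DV A B) B' W).
  by rewrite -(QE B (DV A B') W) -(QE B B' (DV A W)).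
pose RbV := barthel_curv (@brV R n M) (@JV R n M) SV.
pose RhV := hcurv (@brV R n M) (@JV R n M) SV DV.
pose PV := hvcurv (@brV R n M) (@JV R n M) SV DV.
have hE' A : hproj S (vf_val A) = vf_val (hV A) by [].
have brE A B : bracket (vf_val A) (vf_val B) = vf_val (brV A B) by [].
have RbE A B : vf_val (RbV A B) = Rb A B.
  rewrite /RbV /barthel_curv vf_valN vf_valZ !(vf_valD, vf_valN).
  rewrite -!brE -!hE' -!brE.
  by rewrite /Rb /Barthel_curvature /fn_form_form.
have RhE A B B' : vf_val (RhV A B B') = Rh A B B' by [].
have PE A B B' : vf_val (PV A B B') = P A B B' by [].
have C'E A B : vf_val (CV' A B) = C' A B by [].
have FE A : vf_val (FV A) = F A by [].
have [a [b [c [d [e [g k]]]]]] := chern_bianchi (@brV_Dl R n M)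
  (@brV_anti R n M) (@brV_jacobi R n M) (@JV_D R n M) (@JV_JV R n M)
  (@JV_nijenhuis R n M) lift FD FJ Fh DDl DDr D_J D_G D_v D_t C'D C'_s J_C' hJ
  x y z.
split.
  have H : RhV x y z + RhV y z x + RhV z x y = 0 := a.
  move: (etrans (esym (val3 _ _ _)) (congr1 (@vf_val R n M) H)).
  by rewrite (RhE x y z) (RhE y z x) (RhE z x y).
split.
  have H : nabla2 DV (hV x) RbV y z + nabla2 DV (hV y) RbV z x
      + nabla2 DV (hV z) RbV x y =
    CV' (FV (RbV x y)) z + CV' (FV (RbV y z)) x + CV' (FV (RbV z x)) y := b.
  move: (etrans (esym (val3 _ _ _)) (etrans (congr1 (@vf_val R n M) H) (val3 _ _ _))).
  rewrite (nab2 _ _ RbE (hV x) y z) (nab2 _ _ RbE (hV y) z x) (nab2 _ _ RbE (hV z) x y).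
  rewrite (C'E (FV (RbV x y)) z) (C'E (FV (RbV y z)) x) (C'E (FV (RbV z x)) y).
  by rewrite (FE (RbV x y)) (FE (RbV y z)) (FE (RbV z x)) (RbE x y) (RbE y z) (RbE z x).
split; first by move: (congr1 (@vf_val R n M) (c : PV x y z = PV z y x)); rewrite (PE x y z) (PE z y x).
split.
  have H : PV x y z - PV x z y = nabla2 DV (JV z) CV' x y - nabla2 DV (JV y) CV' x z := d.
  move: (etrans (esym (valB _ _)) (etrans (congr1 (@vf_val R n M) H) (valB _ _))).
  by rewrite (nab2 _ _ C'E (JV z) x y) (nab2 _ _ C'E (JV y) x z) (PE x y z) (PE x z y).
split=> [W hW|].
  pose w := mkV hW.
  have H : nabla3 DV (hV x) RhV y z w + nabla3 DV (hV y) RhV z x w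
      + nabla3 DV (hV z) RhV x y w =
    PV x (FV (RbV y z)) w + PV y (FV (RbV z x)) w + PV z (FV (RbV x y)) w := e w.
  move: (etrans (esym (val3 _ _ _)) (etrans (congr1 (@vf_val R n M) H) (val3 _ _ _))).
  rewrite (nab3 _ _ RhE (hV x) y z w) (nab3 _ _ RhE (hV y) z x w).
  rewrite (nab3 _ _ RhE (hV z) x y w).
  rewrite (PE x (FV (RbV y z)) w) (PE y (FV (RbV z x)) w) (PE z (FV (RbV x y)) w).
  by rewrite (FE (RbV x y)) (FE (RbV y z)) (FE (RbV z x)) (RbE x y) (RbE y z) (RbE z x).
split=> W hW; pose w := mkV hW.
  have H : nabla3 DV (hV x) PV y z w - nabla3 DV (hV y) PV x z w
      + nabla3 DV (JV z) RhV x y w =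
    PV x (FV (CV' y z)) w - PV y (FV (CV' x z)) w := g w.
  move: (etrans (esym (valBD _ _ _)) (etrans (congr1 (@vf_val R n M) H) (valB _ _))).
  rewrite (nab3 _ _ RhE (JV z) x y w) (nab3 _ _ PE (hV x) y z w).
  rewrite (nab3 _ _ PE (hV y) x z w) (PE x (FV (CV' y z)) w) (PE y (FV (CV' x z)) w).
  by rewrite (FE (CV' y z)) (FE (CV' x z)) (C'E y z) (C'E x z).
have H : nabla3 DV (JV y) PV x z w = nabla3 DV (JV z) PV x y w := k w.
by move: (congr1 (@vf_val R n M) H); rewrite (nab3 _ _ PE (JV y) x z w) (nab3 _ _ PE (JV z) x y w).
Qed.
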